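(* (1) Fix $T>0$ and $\varepsilon>0$ and let $V\in C^2(\mathbb{R}^m)\cap L^\infty(\mathbb{R}^m)$ with $\max V=0$. Suppose that $\bar q$ minimises $\mathscr{L}_T^\varepsilon$ in $G_T$. Let $E_T\in\mathbb{R}$ be such that $$E_T=\tfrac12\|\bar q'(t)\|^2+V(\bar q(t)/\varepsilon),\quad t\in[0,T].$$ Then there exists a diffeomorphism $\psi\colon[0,1]\to[0,T]$ such that $\bar\gamma:=\bar q\circ\psi$ satisfies $$\mathscr{M}_{E_T}^\varepsilon[\bar\gamma]=\min\mathscr{M}_{E_T}^\varepsilon[\gamma],$$ where the minimisation is over $\gamma\in\Gamma$ such that $$\int_0^1\frac{\|\gamma'(s)\|}{\sqrt{2(E_T-V(\gamma(s)/\varepsilon))}}\,ds=T.$$ (2) Conversely, fix $E>0$ and $\varepsilon>0$. Suppose that $\bar\gamma$ minimises $\mathscr{M}_E^\varepsilon$ in $\Gamma$. Define $T_E>0$ as $$T_E:=\int_0^1\frac{\|\bar\gamma'(s)\|}{\sqrt{2(E-V(\bar\gamma(s)/\varepsilon))}}\,ds.$$ Then there exists a diffeomorphism $\psi\colon[0,1]\to[0,T_E]$ such that $\bar q:=\bar\gamma\circ\psi^{-1}$ satisfies $$\mathscr{L}_{T_E}^\varepsilon[\bar q]=\min\mathscr{L}_{T_E}^\varepsilon[q],$$ where the minimisation is over $q\in G_{T_E}$ such that $$\tfrac12\|q'(t)\|^2+V(q(t)/\varepsilon)=E.$$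
   Context: Curves take values in $\mathbb{R}^m$ and $\|\cdot\|$ is the Euclidean norm. The action functional and the Jacobi functional are $$\mathscr{L}_T^\varepsilon[q]:=\int_0^T\left[\tfrac12\|q'(t)\|^2-V(q(t)/\varepsilon)\right]dt,\qquad \mathscr{M}_E^\varepsilon[\gamma]:=\int_0^1 2\left(E-V(\gamma(s)/\varepsilon)\right)\|\gamma'(s)\|^2\,ds.$$ The points $q_a,q_b\in\mathbb{R}^m$ are fixed, and $$\Gamma:=\{\gamma\in H^1(0,1)\mid\gamma(0)=q_a,\ \gamma(1)=q_b\},\qquad G_T:=\{q\in H^1(0,T)\mid q(0)=q_a,\ q(T)=q_b\}.$$
   Formalization: Part (1) is proved under the added hypothesis V(q̄(t)/ε) < E_T for all t in [0,T] (q̄′ never vanishes); without it no C¹ diffeomorphism ψ need exist, e.g. q̄(t)=t²/2 for V(x)=−x−10 near [−3,3], T=ε=1. *)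

(* Defs.v *)
From mathcomp Require Import all_boot all_order all_algebra.
From mathcomp Require Import all_classical all_reals all_analysis.

Set Implicit Arguments.
Unset Strict Implicit.
Unset Printing Implicit Defensive.

Import Order.TTheory GRing.Theory Num.Theory.
Import numFieldNormedType.Exports.

Local Open Scope classical_set_scope.
Local Open Scope ring_scope.

(* The library norm `|x| on 'rV[R]_m is the sup norm. *)
Definition eucl_norm (R : realType) (m : nat) (x : 'rV[R]_m) : R :=
  Num.sqrt (\sum_(i < m) x ord0 i ^+ 2).

(* C^k(R^m): the partial derivatives up to order k exist and are continuous. *)
Fixpoint Ck (R : realType) (m k : nat) (f : 'rV[R]_m -> R) : Prop :=
  continuous f /\
  if k is k'.+1 then
    forall i : 'I_m, (forall x, derivable f x (delta_mx ord0 i)) /\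
      Ck k' (fun x => 'D_(delta_mx ord0 i) f x)
  else True.

Definition has_max (R : realType) (T : Type) (f : T -> R) (c : R) : Prop :=
  (exists x, f x = c) /\ (forall x, f x <= c).

Definition minimises (R : realType) (X : Type) (F : X -> R) (A : set X)
  (x : X) : Prop := A x /\ forall y, A y -> F x <= F y.

Definition C1 (R : realType) (f : R -> R) : Prop :=
  (forall x, derivable f x 1) /\ continuous (derive1 f).

(* C^1 up to the boundary: f restricts a C^1 function of the whole line. *)
Definition C1_on (R : realType) (D : set R) (f : R -> R) : Prop :=
  exists2 F : R -> R, C1 F & {in D, f =1 F}.

(* psi restricts to a C^1 diffeomorphism [a, b] -> [c, d] with inverse phi;
   values outside these intervals are irrelevant. *)
Definition diffeo (R : realType) (a b c d : R) (psi phi : R -> R) : Prop :=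
  [/\ {homo psi : x / x \in `[a, b] >-> x \in `[c, d]},
      {homo phi : x / x \in `[c, d] >-> x \in `[a, b]},
      {in `[a, b], cancel psi phi} & {in `[c, d], cancel phi psi}] /\
  C1_on `[a, b] psi /\ C1_on `[c, d] phi.

Definition test_function (R : realType) (a b : R) (phi : R -> R) : Prop :=
  let supp := closure [set t | phi t != 0] in
  [/\ C1 phi, compact supp & supp `<=` `]a, b[].

Definition sq_integrable (R : realType) (a b : R) (f : R -> R) : Prop :=
  measurable_fun `]a, b[ f /\
  (@lebesgue_measure R).-integrable `]a, b[ (fun t => (f t ^+ 2)%:E).

Definition is_weak_deriv (R : realType) (m : nat) (a b : R)
  (q v : R -> 'rV[R]_m) : Prop :=
  forall i : 'I_m, sq_integrable a b (fun t => v t ord0 i) /\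
    forall phi, test_function a b phi ->
      \int[@lebesgue_measure R]_(t in `]a, b[) (q t ord0 i * derive1 phi t) =
      - \int[@lebesgue_measure R]_(t in `]a, b[) (v t ord0 i * phi t).

(* An element of H^1(a, b) is given by its continuous representative on
   [a, b] (hence it is in L^2); this is the one whose endpoint values are
   prescribed below. Values outside [a, b] are irrelevant. *)
Definition H1 (R : realType) (m : nat) (a b : R) (q : R -> 'rV[R]_m) : Prop :=
  {within `[a, b], continuous q} /\ exists v, is_weak_deriv a b q v.

(* For q in H1 a b, a weak derivative (unique up to a null set). *)
Definition weak_deriv (R : realType) (m : nat) (a b : R) (q : R -> 'rV[R]_m) :
  R -> 'rV[R]_m := xget (fun=> 0) [set v | is_weak_deriv a b q v].

(* With T = 1 this is the set Gamma of the Jacobi problem. *)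
Definition paths (R : realType) (m : nat) (qa qb : 'rV[R]_m) (T : R) :
  set (R -> 'rV[R]_m) := [set q | H1 0 T q /\ q 0 = qa /\ q T = qb].

Definition action (R : realType) (m : nat) (V : 'rV[R]_m -> R) (eps T : R)
  (q : R -> 'rV[R]_m) : R :=
  \int[@lebesgue_measure R]_(t in `[0, T])
    (2^-1 * eucl_norm (weak_deriv 0 T q t) ^+ 2 - V (eps^-1 *: q t)).

Definition jacobi (R : realType) (m : nat) (V : 'rV[R]_m -> R) (eps E : R)
  (gamma : R -> 'rV[R]_m) : R :=
  \int[@lebesgue_measure R]_(s in `[0, 1])
    (2 * (E - V (eps^-1 *: gamma s)) *
     eucl_norm (weak_deriv 0 1 gamma s) ^+ 2).

(* H^1 curves have derivatives only almost everywhere. *)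
Definition has_energy (R : realType) (m : nat) (V : 'rV[R]_m -> R)
  (eps T E : R) (q : R -> 'rV[R]_m) : Prop :=
  {ae @lebesgue_measure R, forall t, t \in `[0, T] ->
    2^-1 * eucl_norm (weak_deriv 0 T q t) ^+ 2 + V (eps^-1 *: q t) = E}.

(* Extended-real valued: the integral may diverge where E - V is small. *)
Definition transit_time (R : realType) (m : nat) (V : 'rV[R]_m -> R)
  (eps E : R) (gamma : R -> 'rV[R]_m) : \bar R :=
  (\int[@lebesgue_measure R]_(s in `[0%R, 1%R])
    (eucl_norm (weak_deriv 0 1 gamma s) /
     Num.sqrt (2 * (E - V (eps^-1 *: gamma s))))%:E)%E.

(* The integrand of transit_time is meaningful: since Num.sqrt x = 0 for x <= 0
   and x / 0 = 0, this has to be required separately. *)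
Definition transit_defined (R : realType) (m : nat) (V : 'rV[R]_m -> R)
  (eps E : R) (gamma : R -> 'rV[R]_m) : Prop :=
  {ae @lebesgue_measure R, forall s, s \in `[0, 1] ->
    V (eps^-1 *: gamma s) < E}.

(* Main.v *)
Require Import Defs.
From HB Require Import structures.
From mathcomp Require Import all_boot all_order all_algebra.
From mathcomp Require Import all_classical all_reals all_analysis.
From mathcomp Require Import measurable_realfun.
From mathcomp Require Import ring lra.
Import Order.TTheory GRing.Theory Num.Theory.
Import numFieldNormedType.Exports.
Local Open Scope classical_set_scope.
Local Open Scope ring_scope.

(** Write [U] for the rescaled potential, [g = sqrt (2 (E - U))] for the speed of
    a motion of energy [E], and [J] for the Jacobi length of a curve [q], the
    integral of [g |q'|]; [J] does not depend on the parametrisation.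

    A curve of energy [E] has speed [g] almost everywhere, so its action in time
    [T] is [J - E T] ([action_energy]). On [0, 1] the Cauchy-Schwarz inequality
    bounds the Jacobi functional from below by [J ^ 2], with equality when the
    Jacobi speed [g |q'|] is constant ([sqr_jlength_le_jacobi]). Both
    minimisation problems thus amount to minimising [J], provided that every
    competitor can be reparametrised to have energy [E], respectively constant
    Jacobi speed. The required rate of change of parameter may vanish on a set
    of positive measure; it is therefore approached by rates bounded below by a
    positive constant ([action_le_jlength], [jacobi_le_sqr_jlength]).

    For the minimisers themselves the rate is continuous and positive, and the
    change of parameter is a diffeomorphism ([time_change_diffeo]). For a
    minimiser of the action this is immediate, because its energy is [E]; a
    minimiser of the Jacobi functional realises equality in the Cauchy-Schwarz
    inequality, so its Jacobi speed is constant.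

    Competitors are only of class H^1 and their changes of parameter only
    absolutely continuous. A curve of class H^1 is handled as the primitive of
    its weak derivative ([weak_deriv_velocity], by the lemma of du
    Bois-Reymond). If [sigma] is the inverse of the change of parameter of rate
    [h], then the image under [sigma] of the Lebesgue measure has density [h];
    hence the change of variables for measurable functions
    ([ge0_substitution]) and the effect of [sigma] on velocities
    ([velocity_time_change]) and on the functionals
    ([functional_time_change]). *)

Set Implicit Arguments.
Unset Strict Implicit.
Unset Printing Implicit Defensive.

(** * Measures with a density *)

Section density.
Local Open Scope ereal_scope.
Context d (T : measurableType d) (R : realType).
Variable mu : {measure set T -> \bar R}.

(** The measure with density [h] with respect to [mu]. The proofs that [h] is
    measurable and nonnegative are arguments, so that the measure structure
    can be attached to this function. *)
Definition density (h : T -> R) (mh : measurable_fun [set: T] h)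
  (h0 : forall x, (0 <= h x)%R) : set T -> \bar R :=
  fun A => \int[mu]_(x in A) (h x)%:E.

Section density_measure.
Variables (h : T -> R) (mh : measurable_fun [set: T] h)
  (h0 : forall x, (0 <= h x)%R).

Let density0 : density mh h0 set0 = 0.
Proof. exact: integral_set0. Qed.

Let density_ge0 A : 0 <= density mh h0 A.
Proof. by apply: integral_ge0 => x _; rewrite lee_fin. Qed.

Let density_sigma_additive : semi_sigma_additive (density mh h0).
Proof.
apply: semi_sigma_additive_nng_induced => [|x]; last by rewrite lee_fin.
exact/measurable_EFinP.
Qed.

HB.instance Definition _ := isMeasure.Build _ _ _ (density mh h0)
  density0 density_ge0 density_sigma_additive.
End density_measure.

Import HBNNSimple.

(** Integration with respect to a measure given by a density; proved by
    approximating [f] from below by simple functions. *)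
Lemma ge0_integral_density (nu : {measure set T -> \bar R}) (h : T -> R)
    (E : set T) (f : T -> \bar R) :
  measurable_fun setT h -> (forall x, (0 <= h x)%R) ->
  (forall A, measurable A -> nu A = \int[mu]_(x in A) (h x)%:E) ->
  measurable E -> measurable_fun E f -> (forall x, E x -> 0 <= f x) ->
  \int[nu]_(x in E) f x = \int[mu]_(x in E) (f x * (h x)%:E).
Proof.
move=> mh h0 nuE mE mf f0.
pose k := nnsfun_approx mE mf.
have mEh : measurable_fun setT (EFin \o h) by exact/measurable_EFinP.
have cvk x : E x -> (EFin \o k n) x @[n --> \oo] --> f x.
  by move=> Ex; apply: cvg_nnsfun_approx.
have -> : \int[nu]_(x in E) f x =
    limn (fun n => \int[nu]_(x in E) (EFin \o k n) x).
  rewrite -monotone_convergence//.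
  - by apply: eq_integral => x /[!inE] /cvk /cvg_lim ->.
  - by move=> n; exact/measurable_EFinP/measurable_funTS.
  - by move=> n x Ex /=; rewrite lee_fin.
  - by move=> x Ex a b ab; rewrite lee_fin; exact/lefP/nd_nnsfun_approx.
have -> : \int[mu]_(x in E) (f x * (h x)%:E) =
    limn (fun n => \int[mu]_(x in E) ((EFin \o k n) x * (h x)%:E)).
  rewrite -monotone_convergence//.
  - apply: eq_integral => x /[!inE] Ex; apply/esym/cvg_lim => //.
    by apply: cvgeZr => //; exact: cvk.
  - move=> n; apply: emeasurable_funM; apply: measurable_funTS => //.
    exact/measurable_EFinP.
  - by move=> n x Ex /=; rewrite mule_ge0 ?lee_fin.
  - move=> x Ex a b ab /=; rewrite lee_wpmul2r ?lee_fin//.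
    exact/lefP/nd_nnsfun_approx.
congr (limn _); apply/funext => n.
transitivity (\int[nu]_(x in E)
   (\sum_(y \in range (k n)) (y * \1_(k n @^-1` [set y]) x)%:E)).
  by apply: eq_integral => t tE; rewrite /= fimfunE -fsumEFin.
have indick m r : measurable_fun E (fun x => (r * \1_(k m @^-1` [set r]) x)%:E).
  by apply: (measurable_comp measurableT) => //; exact: measurable_funM.
rewrite ge0_integral_fsum//; last by move=> m y Ey; exact: nnfun_muleindic_ge0.
transitivity (\int[mu]_(x in E) (\sum_(y \in range (k n))
    (y * \1_(k n @^-1` [set y]) x)%:E * (h x)%:E)); last first.
  apply: eq_integral => x xE.
  rewrite -ge0_mule_fsuml => [|y]; last exact: nnfun_muleindic_ge0.
  by rewrite fsumEFin // -(fimfunE _ x).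
rewrite ge0_integral_fsum//; last 2 first.
  - by move=> y; apply: emeasurable_funM => //; apply: measurable_funTS.
  - by move=> m y Ey; rewrite mule_ge0 ?lee_fin// -lee_fin nnfun_muleindic_ge0.
apply: eq_fsbigr => r rkn.
under eq_integral do rewrite EFinM.
rewrite integralZl_indic_nnsfun => //.
under [RHS]eq_integral do rewrite EFinM -muleA.
rewrite ge0_integralZl//.
- under [in RHS]eq_integral do rewrite muleC.
  rewrite [in RHS](eq_integral ((EFin \o h) \_ (k n @^-1` [set r]))); last first.
    by move=> x xE; rewrite epatch_indic.
  by rewrite -integral_mkcondr integral_indic// setIC nuE//; apply: measurableI.
- by apply: emeasurable_funM; [exact/measurable_EFinP|exact/measurable_funTS].
- by move=> t Et; rewrite mule_ge0 ?lee_fin.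
- by move: rkn; rewrite inE => -[t _ <-]; rewrite lee_fin.
Qed.

End density.

(** * Integrals on segments and expanding functions *)

Section integrable_real.
Context d (T : measurableType d) (R : realType).
Variable mu : {measure set T -> \bar R}.
Implicit Types (D : set T) (f g : T -> R).

Lemma ae_imply (P Q : T -> Prop) : (forall x, P x -> Q x) ->
  {ae mu, forall x, P x} -> {ae mu, forall x, Q x}.
Proof.
by move=> PQ; apply: filterS PQ; exact: (ae_filter_ringOfSetsType mu).
Qed.

Lemma ae_and (P Q : T -> Prop) : {ae mu, forall x, P x} ->
  {ae mu, forall x, Q x} -> {ae mu, forall x, P x /\ Q x}.
Proof.
move=> aeP aeQ; have aeF := ae_filter_ringOfSetsType mu.
by apply: filterS2 aeP aeQ => x; split.
Qed.

Lemma integrable_fctD D f g : measurable D ->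
  mu.-integrable D (EFin \o f) -> mu.-integrable D (EFin \o g) ->
  mu.-integrable D (EFin \o (fun x => f x + g x)).
Proof.
move=> mD fi gi; have := integrableD mD fi gi; apply: eq_integrable => //.
Qed.

Lemma integrable_fctB D f g : measurable D ->
  mu.-integrable D (EFin \o f) -> mu.-integrable D (EFin \o g) ->
  mu.-integrable D (EFin \o (fun x => f x - g x)).
Proof.
move=> mD fi gi; have := integrableB mD fi gi; apply: eq_integrable => //.
Qed.

Lemma integrable_fctZ D k f : measurable D ->
  mu.-integrable D (EFin \o f) ->
  mu.-integrable D (EFin \o (fun x => k * f x)).
Proof.
move=> mD fi; have := integrableZl mD k fi; apply: eq_integrable => //.
Qed.

End integrable_real.

Section primitives.
Context {R : realType}.
Notation mu := (@lebesgue_measure R).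
Implicit Types (f h : R -> R) (a b c s t : R).

Lemma integrable_subitv a s t f : 0 <= s -> t <= a ->
  mu.-integrable `[0, a] (EFin \o f) -> mu.-integrable `[s, t] (EFin \o f).
Proof.
move=> s0 ta; apply: integrableS => //.
by apply: subset_itv; rewrite bnd_simp.
Qed.

Lemma Rintegral_split a s t f : 0 <= s -> s <= t -> t <= a ->
  mu.-integrable `[0, a] (EFin \o f) ->
  \int[mu]_(x in `[0, t]) f x =
  \int[mu]_(x in `[0, s]) f x + \int[mu]_(x in `[s, t]) f x.
Proof.
move=> s0 st ta fi.
have fi0t := integrable_subitv (lexx 0) ta fi.
have := @Rintegral_itvB R f (BLeft 0) (BRight t) s fi0t.
rewrite !bnd_simp => /(_ s0 st) /eqP; rewrite subr_eq addrC => /eqP ->.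
congr (_ + _); rewrite Rintegral_itv_obnd_cbnd//.
apply: integrableS (integrable_subitv s0 ta fi) => //.
exact: subset_itv_oc_cc.
Qed.

Lemma Rintegral_itv00 f : \int[mu]_(x in `[0, 0]) f x = 0.
Proof. by rewrite set_itv1 Rintegral_set1. Qed.

Lemma continuous_itv_integrable a b f : {within `[a, b], continuous f} ->
  mu.-integrable `[a, b] (EFin \o f).
Proof.
move=> cf; apply: continuous_compact_integrable => //.
exact: segment_compact.
Qed.

Lemma cst_itv_integrable a b c : mu.-integrable `[a, b] (EFin \o (fun=> c)).
Proof.
apply: continuous_itv_integrable; apply: continuous_subspaceT => x.
exact: cvg_cst.
Qed.

Lemma Rintegral_itv_cst s t c : s <= t ->
  \int[mu]_(x in `[s, t]) c = c * (t - s).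
Proof.
rewrite Rintegral_cst//= lebesgue_measure_itv/= lte_fin le_eqVlt.
by move=> /predU1P[->|->//]; rewrite ltxx subrr.
Qed.

Lemma primitive_expand a c h : 0 <= a ->
  mu.-integrable `[0, a] (EFin \o h) -> (forall x, x \in `[0, a] -> c <= h x) ->
  forall s t, 0 <= s -> s <= t -> t <= a ->
    c * (t - s) <= \int[mu]_(x in `[0, t]) h x - \int[mu]_(x in `[0, s]) h x.
Proof.
move=> a0 hi hc s t s0 st ta.
rewrite (Rintegral_split s0 st ta hi) addrAC subrr add0r.
rewrite -(Rintegral_itv_cst c st).
apply: le_Rintegral => //.
- exact: cst_itv_integrable.
- exact: integrable_subitv hi.
- move=> x; rewrite /= in_itv/= => /andP[sx xt]; apply: hc.
  by rewrite in_itv/= (le_trans s0 sx) (le_trans xt ta).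
Qed.

(** The inverse of an expanding function on [0, a]. It is extended by
    constants to a continuous function on the line, so that it is Borel. *)
Lemma expanding_inverse a c (tau : R -> R) : 0 <= a -> 0 < c -> tau 0 = 0 ->
  {within `[0, a], continuous tau} ->
  (forall s t, 0 <= s -> s <= t -> t <= a -> c * (t - s) <= tau t - tau s) ->
  exists sigma : R -> R, [/\ continuous sigma,
    forall t, sigma t \in `[0, a],
    {in `[0, tau a], cancel sigma tau} & {in `[0, a], cancel tau sigma}].
Proof.
move=> a0 c0 tau0 ctau tauE.
have tau_le s t : 0 <= s -> s <= t -> t <= a -> tau s <= tau t.
  move=> s0 st ta; rewrite -subr_ge0; apply: le_trans (tauE _ _ s0 st ta).
  by rewrite mulr_ge0 ?subr_ge0// ltW.
have tau_a : 0 <= tau a by rewrite -tau0 tau_le.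
pose clamp t := Num.max 0 (Num.min t (tau a)).
have clampP t : 0 <= clamp t <= tau a.
  by rewrite /clamp le_max lexx/= ge_max tau_a ge_min lexx orbT.
have ex t : exists s, s \in `[0, a] /\ tau s = clamp t.
  have [|s sa ts] := @IVT R tau 0 a (clamp t) a0 ctau; last by exists s.
  by rewrite tau0 min_l// max_r.
have {ex} [sigma sigmaP] := choice ex.
have lip s t : s <= t -> c * `|sigma t - sigma s| <= `|t - s|.
  move=> st.
  have [ss ts] := sigmaP s; have [st' tt] := sigmaP t.
  have cst : clamp s <= clamp t.
    by rewrite /clamp ge_max le_max lexx/= le_max le_min !ge_min st lexx !orbT.
  have cst2 : clamp t - clamp s <= t - s.
    rewrite lerBlDr [leLHS]/clamp ge_max; apply/andP; split.
      by rewrite addr_ge0 ?subr_ge0//; have /andP[] := clampP s.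
    rewrite ge_min.
    case: (leP s (tau a)) => sa.
      have : s <= clamp s by rewrite /clamp le_max (min_l sa) lexx orbT.
      by move=> ?; apply/orP; left; lra.
    have : tau a <= clamp s by rewrite /clamp le_max (min_r (ltW sa)) lexx orbT.
    by move=> ?; apply/orP; right; lra.
  move: ss st'; rewrite !in_itv/= => /andP[ss1 ss2] /andP[st1 st2].
  rewrite (ger0_norm (_ : 0 <= t - s)) ?subr_ge0//; apply: le_trans cst2.
  case: (leP (sigma s) (sigma t)) => h.
    by rewrite ger0_norm ?subr_ge0// -ts -tt; exact: tauE.
  have := tauE _ _ st1 (ltW h) ss2; rewrite ts tt => h1.
  have : 0 < c * (sigma s - sigma t) by rewrite mulr_gt0// subr_gt0.
  lra.
exists sigma; split.
- move=> t; apply/cvgrPdist_le => /= e e0.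
  near=> s.
  have : c * `|sigma t - sigma s| <= `|t - s|.
    case: (leP s t) => [|/ltW] st; first exact: lip.
    by rewrite distrC (distrC t); exact: lip.
  rewrite -ler_pdivlMl// => /le_trans; apply.
  rewrite ler_pdivrMl//; near: s.
  by apply: (@cvgr_dist_le _ _ _ _ _ id) => //; rewrite mulr_gt0.
- by move=> t; exact: (sigmaP t).1.
- move=> t; rewrite in_itv/= => /andP[t0 ta].
  by rewrite (sigmaP t).2 /clamp min_l// max_r.
- move=> s sa; have [ss ts] := sigmaP (tau s).
  move: (sa) ss; rewrite !in_itv/= => /andP[s0 s1] /andP[ss1 ss2].
  have ts0 : 0 <= tau s by rewrite -tau0 tau_le.
  have ts1 : tau s <= tau a by exact: tau_le.
  have tts : tau (sigma (tau s)) = tau s by rewrite ts /clamp min_l// max_r.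
  apply/eqP; rewrite eq_le; apply/andP; split; rewrite leNgt; apply/negP => h.
    have := tauE _ _ s0 (ltW h) ss2; rewrite tts subrr.
    by rewrite leNgt mulr_gt0// subr_gt0.
  have := tauE _ _ ss1 (ltW h) s1; rewrite tts subrr.
  by rewrite leNgt mulr_gt0// subr_gt0.
Unshelve. all: by end_near. Qed.

End primitives.

(** * Changes of parameter and change of variables *)

Section time_change.
Context {R : realType}.
Notation mu := (@lebesgue_measure R).
Implicit Types (f h sigma : R -> R) (a b c s t : R).

(** The new parameter reached at [s] when it runs at rate [h]. *)
Definition clock h s : R := \int[mu]_(x in `[0, s]) h x.

(** [h] is the rate dt/ds of a change of parameter from s in [0, a] to
    t = clock h s in [0, b]. *)
Definition rate a b h : Prop :=
  [/\ measurable_fun `[0, a] h, exists2 c, 0 < c & {in `[0, a], forall s, c <= h s},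
      mu.-integrable `[0, a] (EFin \o h) & clock h a = b].

(** [sigma] is the inverse of the change of parameter of rate [h], extended
    to a continuous function on the line with values in [0, a]. *)
Definition time_change a b h sigma : Prop :=
  rate a b h /\
  [/\ continuous sigma, forall t, sigma t \in `[0, a],
      {in `[0, b], cancel sigma (clock h)} &
      {in `[0, a], cancel (clock h) sigma}].

Lemma clock0 h : clock h 0 = 0.
Proof. exact: Rintegral_itv00. Qed.

Lemma rate_time_change a b h : 0 <= a -> rate a b h ->
  exists sigma, time_change a b h sigma.
Proof.
move=> a0 rh; have [mh [c c0 hc] hi <-] := rh.
have [sigma [cs sa sK Ks]] := expanding_inverse a0 c0 (clock0 h)
  (parameterized_integral_continuous a0 hi) (primitive_expand a0 hi hc).
by exists sigma; split; [case: rh|split].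
Qed.

Section facts.
Variables (a b : R) (h sigma : R -> R).
Hypotheses (a0 : 0 < a) (tc : time_change a b h sigma).

Lemma clock_lt s t : 0 <= s -> s < t -> t <= a -> clock h s < clock h t.
Proof.
have [[_ [c c0 hc] hi _] _] := tc => s0 st ta; rewrite -subr_gt0.
apply: lt_le_trans (primitive_expand (ltW a0) hi hc s0 (ltW st) ta).
by rewrite mulr_gt0// subr_gt0.
Qed.

Lemma clock_le s t : 0 <= s -> s <= t -> t <= a -> clock h s <= clock h t.
Proof.
by move=> s0; rewrite le_eqVlt => /predU1P[->//|st ta]; exact/ltW/clock_lt.
Qed.

Lemma clock_end : clock h a = b. Proof. by have [[]] := tc. Qed.

Lemma time_change_gt0 : 0 < b.
Proof. by rewrite -clock_end -(clock0 h) clock_lt. Qed.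

Lemma clock_itv s : s \in `[0, a] -> clock h s \in `[0, b].
Proof.
rewrite !in_itv/= => /andP[s0 sa].
by rewrite -{1}(clock0 h) -clock_end !clock_le.
Qed.

Lemma time_change0 : sigma 0 = 0.
Proof.
have [_ [_ _ _ K]] := tc; rewrite -{1}(clock0 h) K//.
by rewrite in_itv/= lexx ltW.
Qed.

Lemma time_change_end : sigma b = a.
Proof.
have [_ [_ _ _ K]] := tc; rewrite -{1}clock_end K//.
by rewrite in_itv/= lexx ltW.
Qed.

(** With half-open intervals the correspondence is exact, including at the
    end points; [t = 0] is excluded. *)
Lemma time_change_image t x y : 0 < t -> t <= b -> 0 <= x -> x <= y -> y <= a ->
  (x < sigma t <= y) = (clock h x < t <= clock h y).
Proof.
move=> t0 tb x0 xy ya; have [_ [_ sa sK _]] := tc.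
have tE : t = clock h (sigma t) by rewrite sK// in_itv/= ltW.
have /andP[s0 s1] : 0 <= sigma t <= a by have := sa t; rewrite in_itv.
rewrite [in RHS]tE; congr (_ && _); apply/idP/idP.
- by move=> ?; apply: clock_lt.
- apply: contraTT; rewrite -!leNgt => ?; apply: clock_le => //.
  exact: le_trans ya.
- by move=> ?; apply: clock_le.
- apply: contraTT; rewrite -!ltNge => ?; apply: clock_lt => //.
  exact: le_trans xy.
Qed.

Let D := `]0, b]%classic : set (measurableTypeR R).
Let mD : measurable D. Proof. exact: measurable_itv. Qed.
Let hh : measurableTypeR R -> R := h \_ `]0, a].

Let mhh : measurable_fun setT hh.
Proof.
have [[mh _ _ _] _] := tc.
apply/(measurable_restrictT _ _).1 => //.
by apply: measurable_funS mh => //; exact: subset_itv_oc_cc.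
Qed.

Let hh0 x : 0 <= hh x.
Proof.
have [[_ [c c0 hc] _ _] _] := tc.
rewrite /hh patchE; case: ifPn => // /set_mem/= /subset_itv_oc_cc xa.
by rewrite (le_trans (ltW c0))// hc.
Qed.

Let msigma : measurable_fun [set: measurableTypeR R]
  (sigma : R -> measurableTypeR R).
Proof. have [_ [cs _ _ _]] := tc; exact: continuous_measurable_fun. Qed.

(* The image under [sigma] of the Lebesgue measure on ]0, b]. *)
Let nu : {measure set (measurableTypeR R) -> \bar R}.
Proof.
unshelve refine (pushforward (mrestr mu mD)
  (sigma : measurableTypeR R -> measurableTypeR R)).
exact: msigma.
Defined.

(* This image has density [h] on ]0, a]: both measures give the value
   [clock h y - clock h x] to the subinterval ]x, y]. *)
Let nuE A : measurable A -> nu A = (\int[mu]_(x in A) (hh x)%:E)%E.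
Proof.
have [[_ _ hi _] _] := tc.
move=> mA; rewrite -[RHS]/(density mu mhh hh0 A).
apply: (@measure_unique _ R (measurableTypeR R) (@ocitv R)
  (fun n => `](- n%:R), n%:R]%classic) _ _ _ _ nu (density mu mhh hh0)) => //.
- exact: ocitvI.
- by move=> i; exact: is_ocitv.
- apply/seteqP; split => // x _.
  have := archimedean.Num.Theory.archi_boundP (normr_ge0 x).
  rewrite ltr_norml => /andP[x1 x2].
  by exists (Num.bound `|x|) => //=; rewrite in_itv/= x1 ltW.
- move=> _ [[x y] _ <-] /=.
  rewrite /nu/= /pushforward/mrestr /density.
  pose x' := Num.max x 0; pose y' := Num.min y a.
  have x'0 : 0 <= x' by rewrite le_max lexx orbT.
  have y'a : y' <= a by rewrite ge_min lexx orbT.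
  have itvE u : 0 < u -> u <= a -> (u \in `]x, y]) = (x' < u <= y').
    by move=> u0 ua; rewrite in_itv/= gt_max le_min u0 ua !andbT.
  have -> : (\int[mu]_(z in `]x, y]) (hh z)%:E =
      \int[mu]_(z in `]x', y']) (h z)%:E)%E.
    rewrite integral_mkcond [RHS]integral_mkcond; apply: eq_integral => z _.
    rewrite !patchE /hh patchE.
    have -> : (z \in `]x', y']%classic) =
        (z \in `]x, y]%classic) && (z \in `]0, a]%classic).
      rewrite /x' /y' !mem_setE /= !in_itv/= gt_max le_min.
      by rewrite -!andbA; do !bool_congr.
    by case: (z \in `]x, y]%classic) => //=; case: ifP.
  have -> : sigma @^-1` `]x, y] `&` D =
      [set t | 0 < t <= b /\ x' < sigma t <= y'].
    have [_ [_ sa sK _]] := tc.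
    apply/seteqP; split => t /=; rewrite /D/= !in_itv/=.
      move=> [+ /andP[t0 tb]]; rewrite t0 tb; split => //.
      have /andP[st0 st1] : 0 < sigma t <= a.
        have := sa t; rewrite in_itv/= le_eqVlt => /andP[/predU1P[st0|->]->//].
        have : clock h (sigma t) = t by rewrite sK// in_itv/= ltW.
        by rewrite -st0 clock0 => t00; rewrite t00 ltxx in t0.
      by rewrite -itvE// in_itv.
    move=> [/andP[t0 tb] /andP[xs sy]]; rewrite t0 tb; split => //.
    by move: xs sy; rewrite gt_max le_min => /andP[-> _] /andP[-> _].
  have [xy|yx] := leP x' y'; last first.
    rewrite (_ : [set t | _ /\ _] = set0).
      by rewrite set_itv_ge ?integral_set0 ?measure0// bnd_simp -leNgt ltW.
    apply/seteqP; split => // t [_ /andP[xt ty]].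
    by have := lt_le_trans xt (le_trans ty (ltW yx)); rewrite ltxx.
  rewrite (_ : [set t | _ /\ _] = `]clock h x', clock h y']%classic); last first.
    apply/seteqP; split => t.
      move=> [/andP[t0 tb]]; rewrite (time_change_image t0 tb x'0 xy y'a).
      by rewrite /= in_itv.
    rewrite /= in_itv/= => /andP[xt ty].
    have t0 : 0 < t.
      by apply: le_lt_trans xt; rewrite -(clock0 h) clock_le// (le_trans xy).
    have tb : t <= b by rewrite (le_trans ty)// -clock_end clock_le// (le_trans x'0).
    by rewrite t0 tb; split => //; rewrite time_change_image// xt.
  have hixy : mu.-integrable `[x', y'] (EFin \o h) by exact: integrable_subitv hi.
  have hixy' : mu.-integrable `]x', y'] (EFin \o h).
    by apply: integrableS hixy => //; exact: subset_itv_oc_cc.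
  rewrite lebesgue_measure_itv/= lte_fin.
  have -> : (\int[mu]_(z in `]x', y']) (h z)%:E)%E = (clock h y' - clock h x')%:E.
    rewrite -[LHS]fineK; last by apply: integrable_fin_num => //.
    congr EFin; rewrite -[LHS]/(\int[mu]_(z in `]x', y']) h z).
    rewrite Rintegral_itv_obnd_cbnd//.
    by rewrite /clock (Rintegral_split x'0 xy y'a hi) addrAC subrr add0r.
  case: ifPn => [//|]; rewrite -leNgt => yx.
  suff -> : clock h x' = clock h y' by rewrite subrr.
  by apply/eqP; rewrite eq_le yx clock_le.
- move=> k; rewrite /nu/= /pushforward/mrestr.
  apply: le_lt_trans (_ : mu D < _)%E; last first.
    by rewrite lebesgue_measure_itv/=; case: ifP; rewrite ?ltry.
  apply: le_measure; rewrite ?inE//; apply: measurableI => //.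
  by rewrite -[X in measurable X]setTI; exact: msigma.
Qed.

Let mrestrE (A : set (measurableTypeR R)) : measurable A ->
  mrestr mu mD A = (\int[mu]_(x in A) (\1_D x)%:E)%E.
Proof. by move=> mA; rewrite integral_indic// setIC. Qed.

(** Change of variables for functions that are only measurable. *)
Lemma ge0_substitution (F : R -> \bar R) : measurable_fun `[0, a] F ->
  (forall s, s \in `[0, a] -> (0 <= F s)%E) ->
  (\int[mu]_(t in `[0%R, b]) F (sigma t) =
   \int[mu]_(s in `[0%R, a]) (F s * (h s)%:E))%E.
Proof.
move=> mF F0; have [_ [_ sa _ _]] := tc.
pose G : measurableTypeR R -> \bar R := F \_ `[0, a].
have G0 s : (0 <= G s)%E.
  by rewrite /G patchE; case: ifPn => // /set_mem /F0.
have mG : measurable_fun setT G.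
  by apply/(measurable_restrictT _ _).1.
have mGs : measurable_fun setT (G \o sigma) by exact: measurableT_comp.
transitivity (\int[mu]_(t in D) (G \o sigma) t)%E.
  rewrite integral_itv_obnd_cbnd; last exact: measurable_funTS.
  by apply: eq_integral => t _; rewrite /G/= patchE mem_set//=; exact: sa.
transitivity (\int[nu]_s G s)%E.
  rewrite (ge0_integral_pushforward msigma)//.
  rewrite preimage_setT.
  rewrite (ge0_integral_density (mu := mu) (h := \1_D) _ _ mrestrE)//.
  - rewrite [LHS]integral_mkcond; apply: eq_integral => t _.
    rewrite patchE indicE; case: ifPn => tD; last by rewrite mule0.
    by rewrite mule1.
  - by move=> x _; exact: G0.
rewrite (ge0_integral_density mhh hh0 nuE)//.
transitivity (\int[mu]_(s in `]0%R, a]) (G s * (hh s)%:E))%E.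
  rewrite [RHS]integral_mkcond; apply: eq_integral => s _.
  rewrite patchE; case: ifPn => // sa0.
  by rewrite /hh patchE (negbTE sa0) mule0.
transitivity (\int[mu]_(s in `]0%R, a]) (F s * (h s)%:E))%E.
  apply: eq_integral => s s0; rewrite /G /hh !patchE s0 mem_set//=.
  by apply: subset_itv_oc_cc; exact: set_mem.
apply: integral_itv_obnd_cbnd.
have [[mh _ _ _] _] := tc.
apply: (measurable_funS (measurable_itv `[0, a])); first exact: subset_itv_oc_cc.
by apply: emeasurable_funM => //; exact/measurable_EFinP.
Qed.

Lemma rate_gt0 s : s \in `[0, a] -> 0 < h s.
Proof. by have [[_ [c c0 hc] _ _] _] := tc => /hc; exact: lt_le_trans. Qed.

Lemma integral_substitution f : measurable_fun `[0, a] f ->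
  (\int[mu]_(t in `[0%R, b]) (f (sigma t))%:E =
   \int[mu]_(s in `[0%R, a]) (f s * h s)%:E)%E.
Proof.
move=> mf; have mfE : measurable_fun `[0, a] (EFin \o f) by exact/measurable_EFinP.
rewrite integralE [RHS]integralE; congr (_ - _)%E.
  transitivity (\int[mu]_(t in `[0%R, b]) ((EFin \o f)^\+ (sigma t)))%E.
    by apply: eq_integral => t _; rewrite /= ?funeposE ?funenegE.
  rewrite ge0_substitution//; last exact: measurable_funepos.
  apply: eq_integral => s /set_mem /= /rate_gt0 hs.
  rewrite !funeposE/= -!EFin_max -EFinM; congr EFin.
  by rewrite maxr_pMl ?ltW// mul0r.
transitivity (\int[mu]_(t in `[0%R, b]) ((EFin \o f)^\- (sigma t)))%E.
  by apply: eq_integral => t _; rewrite /= ?funeposE ?funenegE.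
rewrite ge0_substitution//; last exact: measurable_funeneg.
apply: eq_integral => s /set_mem /= /rate_gt0 hs.
rewrite !funenegE/= -!EFin_max -EFinM; congr EFin.
by rewrite maxr_pMl ?ltW// mul0r mulNr.
Qed.

Lemma Rintegral_substitution f : measurable_fun `[0, a] f ->
  \int[mu]_(t in `[0, b]) f (sigma t) = \int[mu]_(s in `[0, a]) (f s * h s).
Proof. by move=> mf; congr fine; exact: integral_substitution. Qed.

Lemma measurable_time_change f : measurable_fun `[0, a] f ->
  measurable_fun `[0, b] (f \o sigma).
Proof.
have [_ [_ sa _ _]] := tc => mf.
apply: (@eq_measurable_fun _ _ _ _ _ ((f \_ `[0, a]) \o sigma)).
  by move=> t _; rewrite /= patchE mem_set//=; exact: sa.
apply: measurable_funTS; apply: measurableT_comp; last exact: msigma.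
by apply/(measurable_restrictT _ _).1.
Qed.

Lemma integrable_substitution f : measurable_fun `[0, a] f ->
  mu.-integrable `[0, a] (EFin \o (f \* h)) ->
  mu.-integrable `[0, b] (EFin \o (f \o sigma)).
Proof.
move=> mf /integrableP[_ fh]; apply/integrableP; split.
  by apply/measurable_EFinP; exact: measurable_time_change.
rewrite (_ : (\int[mu]_(x in _) _)%E =
  (\int[mu]_(x in `[0%R, b]) ((Num.norm \o f) (sigma x))%:E)%E)//.
rewrite integral_substitution; last exact: measurableT_comp.
apply: le_lt_trans fh; rewrite le_eqVlt; apply/orP; left; apply/eqP.
apply: eq_integral => s /set_mem /= /rate_gt0 hs.
by rewrite normrM (gtr0_norm hs).
Qed.

Lemma Rintegral_substitution_upto f t : measurable_fun `[0, a] f ->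
  t \in `[0, b] ->
  \int[mu]_(x in `[0, t]) f (sigma x) =
  \int[mu]_(s in `[0, sigma t]) (f s * h s).
Proof.
have [_ [_ sa sK Ks]] := tc => mf tb.
have := tb; rewrite in_itv/= => /andP[t0 t1].
have := sa t; rewrite in_itv/= => /andP[s0 s1].
pose g := f \_ `[0, sigma t].
have mg : measurable_fun `[0, a] g.
  apply: measurable_funTS; apply/(measurable_restrictT _ _).1 => //.
  apply: measurable_funS mf => //; apply: subset_itv; by rewrite bnd_simp.
transitivity (\int[mu]_(x in `[0, b]) g (sigma x)).
  rewrite [LHS]Rintegral_mkcond [RHS]Rintegral_mkcond; apply: eq_Rintegral => x _.
  rewrite !patchE /g patchE !mem_setE.
  case: (boolP (x \in `[0, b])) => xb; last first.
    rewrite ifF//; apply: contraNF xb; rewrite !in_itv/= => /andP[-> xt].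
    exact: le_trans t1.
  suff -> : (x \in `[0, t]) = (sigma x \in `[0, sigma t]) by [].
  move: (xb) (sa x); rewrite !in_itv/= => /andP[x0 x1] /andP[sx0 sx1].
  rewrite x0 sx0/=; apply/idP/idP; apply: contraTT; rewrite -!ltNge => xt.
    have := clock_lt s0 xt sx1; rewrite !sK//.
  rewrite ltNge; apply/negP => st.
  have := clock_le sx0 st s1; rewrite !sK//.
  by rewrite leNgt xt.
rewrite Rintegral_substitution// [LHS]Rintegral_mkcond [RHS]Rintegral_mkcond.
apply: eq_Rintegral => x _; rewrite !patchE /g patchE !mem_setE.
case: (boolP (x \in `[0, sigma t])) => xs; last first.
  by rewrite mul0r; case: ifP.
by rewrite ifT//; move: xs; rewrite !in_itv/= => /andP[-> /le_trans->].
Qed.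

Lemma ae_time_change (P : R -> Prop) :
  {ae mu, forall s, s \in `[0, a] -> P s} ->
  {ae mu, forall t, t \in `[0, b] -> P (sigma t)}.
Proof.
have [_ [_ sa _ _]] := tc.
move=> [N [mN N0 PN]]; exists (`[0, b] `&` sigma @^-1` N); split.
- apply: measurableI => //; rewrite -[X in measurable X]setTI.
  exact: msigma.
- have mNs : measurable (sigma @^-1` N).
    by rewrite -[X in measurable X]setTI; exact: msigma.
  have mNi : measurable_fun (`[0, a]%classic : set R) (\1_N : R -> R).
    exact: measurable_indic.
  transitivity (\int[mu]_(t in `[0%R, b]) ((\1_N : R -> R) (sigma t))%:E)%E.
    rewrite -[RHS]/(\int[mu]_(t in `[0%R, b]) (\1_(sigma @^-1` N) t)%:E)%E.
    by rewrite integral_indic// setIC.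
  rewrite integral_substitution//.
  have [[mh _ _ _] _] := tc.
  have NaN0 : mu (`[0, a] `&` N) = 0%E.
    by apply: (subset_measure0 _ mN _ N0) => //; exact: measurableI.
  transitivity (\int[mu]_(s in `[0%R, a] `&` N) (h s)%:E)%E.
    rewrite integral_mkcondr; apply: eq_integral => s _.
    rewrite patchE indicE; case: ifPn => _; first by rewrite mul1r.
    by rewrite mul0r.
  apply: null_set_integral => //; first exact: measurableI.
  apply/measurable_EFinP; apply: (measurable_funS (measurable_itv `[0, a])) => //.
- move=> t /= /not_implyP[tb nP]; split => //; apply: PN => /=.
  by move=> /(_ (sa t)).
Qed.

End facts.
End time_change.

(** * Integration by parts against test functions *)

Section weak_derivative.
Context {R : realType}.
Notation mu := (@lebesgue_measure R).
Implicit Types (f q v w eta : R -> R) (a s t x y : R).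

(** A function whose increments are bounded by the product of the increments
    of the variable and of a fixed function is constant: subdivide [0, a]. *)
Lemma constant_of_increments a (F H : R -> R) : 0 <= a ->
  (forall s t, 0 <= s -> s <= t -> t <= a ->
    `|F t - F s| <= (t - s) * (H t - H s)) -> F a = F 0.
Proof.
move=> a0 FH.
have bound n : `|F a - F 0| <= (a / n.+1%:R) * (H a - H 0).
  pose d := a / n.+1%:R.
  have d0 : 0 <= d by rewrite divr_ge0.
  have dN : d *+ n.+1 = a by rewrite -[LHS]mulr_natr /d divfK// pnatr_eq0.
  have step i : (i <= n.+1)%N ->
      `|F (d *+ i) - F 0| <= d * (H (d *+ i) - H 0).
    elim: i => [_|i IH iN]; first by rewrite mulr0n !subrr normr0 mulr0.
    have dia : d *+ i.+1 <= a.
      by rewrite -dN; exact: ler_wpMn2l.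
    have dd : d *+ i.+1 - d *+ i = d by rewrite mulrS addrK.
    rewrite (_ : F (d *+ i.+1) - F 0 =
      (F (d *+ i.+1) - F (d *+ i)) + (F (d *+ i) - F 0)); last by rewrite addrA subrK.
    apply: (le_trans (ler_normD _ _)).
    rewrite (_ : d * (H (d *+ i.+1) - H 0) =
      d * (H (d *+ i.+1) - H (d *+ i)) + d * (H (d *+ i) - H 0)); last by ring.
    apply: lerD; last exact/IH/ltnW.
    have := FH (d *+ i) (d *+ i.+1); rewrite dd; apply => //.
      by rewrite mulrn_wge0.
    by rewrite ler_wpMn2l.
  have := step n.+1 (leqnn _).
  by rewrite dN.
apply/eqP; rewrite -subr_eq0 -normr_le0; apply/ler_addgt0Pr => e e0.
rewrite add0r.
pose M := a * `|H a - H 0| / e.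
have M0 : 0 <= M by rewrite divr_ge0 ?mulr_ge0 ?normr_ge0 ?(ltW e0).
have := archimedean.Num.Theory.archi_boundP M0.
set N := Num.Def.archi_bound M => MN.
apply: le_trans (bound N) _.
apply: (@le_trans _ _ (a / N.+1%:R * `|H a - H 0|)).
  by rewrite ler_wpM2l ?divr_ge0// ler_norm.
rewrite mulrAC ler_pdivrMr// -ler_pdivrMl// [leLHS]mulrC -/M.
by rewrite (le_trans (ltW MN))// ler_nat.
Qed.

Lemma integrable_mul_continuous s t f g :
  {within `[s, t], continuous g} -> mu.-integrable `[s, t] (EFin \o f) ->
  mu.-integrable `[s, t] (EFin \o (fun x => f x * g x)).
Proof.
move=> cg fi.
have -> : EFin \o (fun x => f x * g x) = ((EFin \o f) \* (EFin \o g))%E.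
  by apply/funext => x /=; rewrite EFinM.
apply: integrableMl => //.
  exact: subspace_continuous_measurable_fun.
have : compact [set g x | x in `[s, t]].
  by apply: continuous_compact => //; exact: segment_compact.
move=> /compact_bounded[M [Mr MB]]; exists M; split => // N MN x xst.
by apply: (MB N MN); exists x.
Qed.

Lemma C1_continuous f : C1 f -> continuous f.
Proof. by move=> [df _] x; apply/differentiable_continuous/derivable1_diffP. Qed.

Lemma C1_FTC2 f s t : C1 f -> s <= t ->
  \int[mu]_(x in `[s, t]) derive1 f x = f t - f s.
Proof.
move=> C1f; rewrite le_eqVlt => /predU1P[->|st].
  by rewrite set_itv1 Rintegral_set1 subrr.
rewrite /Rintegral (@continuous_FTC2 _ _ f)//.
- apply: continuous_subspaceT; exact: C1f.2.
- split; [by move=> x _; exact: C1f.1|..].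
    by apply: cvg_at_right_filter; exact: C1_continuous.
  by apply: cvg_at_left_filter; exact: C1_continuous.
Qed.

Lemma C1_lipschitz a f : C1 f -> exists2 K, 0 <= K &
  forall x, x \in `[0, a] -> `|derive1 f x| <= K.
Proof.
move=> [_ cf].
have : compact [set derive1 f x | x in `[0, a]].
  apply: continuous_compact; last exact: segment_compact.
  exact: continuous_subspaceT.
move=> /compact_bounded[M [Mr MB]]; exists (`|M| + 1) => //.
move=> x xa; apply: (MB (`|M| + 1)); last by exists x.
by rewrite (le_lt_trans (ler_norm _))// ltrDl.
Qed.

Lemma test_function_vanish a eta : test_function 0 a eta ->
  forall x, x \notin `]0, a[ -> eta x = 0.
Proof.
move=> [_ _ supp] x; apply: contraNeq => etax.
by apply: supp; apply: subset_closure.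
Qed.

Lemma Rintegral_oo_cc a f : mu.-integrable `[0, a] (EFin \o f) ->
  \int[mu]_(x in `]0, a[) f x = \int[mu]_(x in `[0, a]) f x.
Proof.
move=> fi.
rewrite Rintegral_itv_bndo_bndc ?Rintegral_itv_obnd_cbnd//.
  by apply: integrableS fi => //; exact: subset_itv_oc_cc.
by apply: integrableS fi => //; exact: subset_itv_oo_cc.
Qed.

(** Integration by parts when only one factor is of class C^1. Let F t be the
    integral of q eta' + v eta over [0, t], minus q t * eta t. Its increment
    on [s, t] is the integral of (q - q t) eta' + v (eta - eta s), hence at
    most a constant times (t - s) times the integral of |v| over [s, t]. So F
    is constant. *)
Lemma primitive_by_parts a q v eta : 0 <= a ->
  {within `[0, a], continuous q} -> mu.-integrable `[0, a] (EFin \o v) ->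
  (forall t, t \in `[0, a] -> q t = q 0 + \int[mu]_(x in `[0, t]) v x) ->
  test_function 0 a eta ->
  \int[mu]_(t in `]0, a[) (q t * derive1 eta t) =
  - \int[mu]_(t in `]0, a[) (v t * eta t).
Proof.
move=> a0 cq vi qE teta.
have [C1eta _ _] := teta; have ceta := C1_continuous C1eta.
have [K K0 KP] := C1_lipschitz a C1eta.
have i1 : mu.-integrable `[0, a] (EFin \o (fun t => q t * derive1 eta t)).
  apply: integrable_mul_continuous; first exact: continuous_subspaceT C1eta.2.
  exact: continuous_itv_integrable.
have i2 : mu.-integrable `[0, a] (EFin \o (fun t => v t * eta t)).
  by apply: integrable_mul_continuous => //; exact: continuous_subspaceT.
rewrite !Rintegral_oo_cc//; apply/eqP; rewrite -addr_eq0 -RintegralD//; apply/eqP.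
pose G t := q t * derive1 eta t + v t * eta t.
have iG : mu.-integrable `[0, a] (EFin \o G).
  exact: integrable_fctD.
pose F t := \int[mu]_(x in `[0, t]) G x - q t * eta t.
pose H t := 2 * K * \int[mu]_(x in `[0, t]) `|v x|.
have : F a = F 0.
  apply: (@constant_of_increments a F H) => // s t s0 st ta.
  have ivn : mu.-integrable `[0, a] (EFin \o (fun x => `|v x|)).
    exact: integrable_norm.
  have ivst := integrable_subitv s0 ta vi.
  have invst := integrable_subitv s0 ta ivn.
  set D := \int[mu]_(x in `[s, t]) `|v x|.
  have D0 : 0 <= D by apply: Rintegral_ge0.
  have -> : H t - H s = 2 * K * D.
    by rewrite /H (Rintegral_split s0 st ta ivn) -/D; ring.
  have tin : t \in `[0, a] by rewrite in_itv/= ta (le_trans s0).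
  have sin : s \in `[0, a] by rewrite in_itv/= s0 (le_trans st).
  have sub x : s <= x -> x <= t -> x \in `[0, a].
    by move=> sx xt; rewrite in_itv/= (le_trans s0)//= (le_trans xt).
  have qts : q t - q s = \int[mu]_(x in `[s, t]) v x.
    by rewrite (qE t)// (qE s)// (Rintegral_split s0 st ta vi); ring.
  have FE : F t - F s = \int[mu]_(x in `[s, t])
      ((q x - q t) * derive1 eta x + v x * (eta x - eta s)).
    have iGst := integrable_subitv s0 ta iG.
    have j1 : mu.-integrable `[s, t] (EFin \o (fun x => q t * derive1 eta x)).
      apply: continuous_itv_integrable; apply: continuous_subspaceT => x.
      by apply: cvgM; [exact: cvg_cst|exact: C1eta.2].
    have j2 : mu.-integrable `[s, t] (EFin \o (fun x => v x * eta s)).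
      apply: integrable_mul_continuous => //.
      by apply: continuous_subspaceT => x; exact: cvg_cst.
    have j3 : mu.-integrable `[s, t] (EFin \o (fun x => G x - q t * derive1 eta x)).
      exact: integrable_fctB.
    transitivity (\int[mu]_(x in `[s, t])
        ((G x - q t * derive1 eta x) - v x * eta s)); last first.
      by apply: eq_Rintegral => x _; rewrite /G; ring.
    rewrite RintegralB// RintegralB// RintegralZr// -qts RintegralZl//; last first.
      by apply: continuous_itv_integrable; exact: continuous_subspaceT C1eta.2.
    rewrite C1_FTC2// /F (Rintegral_split s0 st ta iG); ring.
  pose N x := \int[mu]_(y in `[0, x]) `|v y|.
  have Nsub x y : 0 <= x -> x <= y -> y <= a ->
      \int[mu]_(z in `[x, y]) `|v z| = N y - N x.
    by move=> x0 xy ya; rewrite /N (Rintegral_split x0 xy ya ivn); ring.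
  have qxt x : s <= x -> x <= t -> `|q x - q t| <= D.
    move=> sx xt; have x0 := le_trans s0 sx; have xa := le_trans xt ta.
    rewrite distrC (qE t)// (qE x ltac:(exact: sub)) (Rintegral_split x0 xt ta vi).
    rewrite (_ : forall u y z : R, u + (y + z) - (u + y) = z); last by move=> *; ring.
    apply: (le_trans (le_normr_Rintegral _ (integrable_subitv x0 ta vi))) => //.
    rewrite /D !Nsub// lerB// -subr_ge0 -Nsub//.
    exact: Rintegral_ge0.
  have etaxs x : s <= x -> x <= t -> `|eta x - eta s| <= K * (t - s).
    move=> sx xt.
    have ies : mu.-integrable `[s, x] (EFin \o derive1 eta).
      by apply: continuous_itv_integrable; exact: continuous_subspaceT C1eta.2.
    rewrite -(C1_FTC2 C1eta sx).
    apply: (le_trans (le_normr_Rintegral _ ies)) => //.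
    apply: (@le_trans _ _ (\int[mu]_(y in `[s, x]) K)).
      apply: le_Rintegral => //; [exact: integrable_norm|exact: cst_itv_integrable|].
      move=> y /=; rewrite in_itv/= => /andP[sy yx].
      by apply: KP; apply: sub => //; exact: le_trans xt.
    rewrite Rintegral_itv_cst// ler_wpM2l// lerB//.
  rewrite FE.
  have ifin : mu.-integrable `[s, t] (EFin \o (fun x =>
      (q x - q t) * derive1 eta x + v x * (eta x - eta s))).
    apply: integrable_fctD => //.
      apply: continuous_itv_integrable.
      have cqst : {within `[s, t], continuous q}.
        by apply: continuous_subspaceW cq; apply: subset_itv; rewrite bnd_simp.
      move=> x; apply: cvgM; last exact: (continuous_subspaceT C1eta.2).
      by apply: cvgB; [exact: cqst|exact: cvg_cst].
    apply: integrable_mul_continuous => //; apply: continuous_subspaceT => x.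
    by apply: cvgB; [exact: ceta|exact: cvg_cst].
  have ibound : mu.-integrable `[s, t]
      (EFin \o (fun x => D * K + (K * (t - s)) * `|v x|)).
    apply: integrable_fctD => //; first exact: cst_itv_integrable.
    exact: integrable_fctZ.
  apply: (le_trans (le_normr_Rintegral _ ifin)) => //.
  apply: (@le_trans _ _ (\int[mu]_(x in `[s, t])
      (D * K + (K * (t - s)) * `|v x|))).
    apply: le_Rintegral => //; first exact: integrable_norm.
    move=> x /=; rewrite in_itv/= => /andP[sx xt].
    rewrite (le_trans (ler_normD _ _))// !normrM; apply: lerD.
      by apply: ler_pM => //; [exact: qxt|apply: KP; exact: sub].
    by rewrite mulrC ler_wpM2r// etaxs.
  rewrite RintegralD//; [|exact: cst_itv_integrable|exact: integrable_fctZ].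
  rewrite Rintegral_itv_cst// RintegralZl// -/D.
  by rewrite le_eqVlt; apply/orP; left; apply/eqP; ring.
rewrite /F Rintegral_itv00 (test_function_vanish teta).
  rewrite (test_function_vanish teta (x := 0)).
    by rewrite !mulr0 !subr0.
  by rewrite in_itv/= ltxx.
by rewrite in_itv/= ltxx andbF.
Qed.
End weak_derivative.

(** * The lemma of du Bois-Reymond *)

Section du_bois_reymond.
Context {R : realType}.
Notation mu := (@lebesgue_measure R).
Implicit Types (f g k q v w eta : R -> R) (a c d e s t u x y : R).

Lemma Rintegral_restrict a y k :
  \int[mu]_(t in `[0, y]) (k \_ `[0, a]) t =
  if y <= a then \int[mu]_(t in `[0, y]) k t else \int[mu]_(t in `[0, a]) k t.
Proof.
have [ya|ay] := leP y a.
  apply: eq_Rintegral => t; rewrite mem_setE in_itv/= => /andP[t0 ty].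
  by rewrite patchE mem_setE in_itv/= t0 (le_trans ty).
rewrite [LHS]Rintegral_mkcond [RHS]Rintegral_mkcond; apply: eq_Rintegral => t _.
rewrite !patchE !mem_setE !in_itv/=.
case: (leP 0 t) => //= t0; case: (leP t a) => ta; last by rewrite if_same.
by rewrite (le_trans ta (ltW ay)).
Qed.

Lemma eq_primitive_restrict a f g : 0 <= a -> (forall t, t \in `[0, a] ->
    \int[mu]_(x in `[0, t]) f x = \int[mu]_(x in `[0, t]) g x) ->
  (fun y => \int[mu]_(t in `[0, y]) (f \_ `[0, a]) t) =
  (fun y => \int[mu]_(t in `[0, y]) (g \_ `[0, a]) t).
Proof.
move=> a0 fg; apply/funext => y.
have [y0|y0] := leP 0 y; last first.
  by rewrite set_itv_ge ?Rintegral_set0// bnd_simp -ltNge.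
rewrite Rintegral_restrict Rintegral_restrict.
case: leP => ya; apply: fg; rewrite in_itv/= ?y0 ?a0 ?lexx//.
Qed.

(** An integrable function is determined almost everywhere by its primitive,
    as the latter is differentiable almost everywhere. *)
Lemma primitive_ae_inj a f g :
  mu.-integrable `[0, a] (EFin \o f) -> mu.-integrable `[0, a] (EFin \o g) ->
  (forall t, t \in `[0, a] ->
    \int[mu]_(x in `[0, t]) f x = \int[mu]_(x in `[0, t]) g x) ->
  {ae mu, forall t, t \in `[0, a] -> f t = g t}.
Proof.
move=> fi gi fg.
have FTC k : mu.-integrable `[0, a] (EFin \o k) ->
    {ae mu, forall x, 0 < x ->
      derive1 (fun y => \int[mu]_(t in `[0, y]) (k \_ `[0, a]) t) x =
      (k \_ `[0, a]) x}.
  move=> ki.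
  have kiT : mu.-integrable setT (EFin \o (k \_ `[0, a])).
    by rewrite -restrict_EFin; apply/integrable_restrict => //; rewrite setTI.
  have kl : locally_integrable [set: R] (k \_ `[0, a]).
    by apply: integrable_locally_restrict.
  have : forall y, mu.-integrable [set` Interval (BLeft 0) (BRight y)]
      (EFin \o (k \_ `[0, a])).
    by move=> y; apply: integrableS kiT.
  move=> /FTC1 /(_ kl); apply: ae_imply => x /=; rewrite lte_fin => + x0.
  by move=> /(_ x0)[].
have ftc_f := FTC f fi; have ftc_g := FTC g gi.
have N0 : {ae mu, forall x : R, x != 0}.
  exists [set 0]; split => //; first exact: lebesgue_measure_set1.
  by move=> x /= /negP; rewrite negbK => /eqP.
apply: ae_imply (ae_and N0 (ae_and ftc_f ftc_g)) => x [x0 [hf hg]].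
rewrite in_itv/= => /andP[x0' xa].
have xpos : 0 < x by rewrite lt_neqAle eq_sym x0.
have xin : x \in `[0, a]%classic by rewrite mem_setE in_itv/= x0' xa.
have fx : (f \_ `[0, a]) x = f x by rewrite patchE xin.
have gx : (g \_ `[0, a]) x = g x by rewrite patchE xin.
rewrite -fx -gx -(hf xpos) -(hg xpos).
by rewrite (eq_primitive_restrict (le_trans x0' xa) fg).
Qed.

(** The function u |-> max(u, 0)^2, of class C^1, from which the test
    functions below are built. *)
Definition sqpos u : R := Num.max u 0 ^+ 2.

(** A C^1 step: [ramp d u] vanishes for u <= 0 and equals 2 d^2 for
    u >= 2 d; its derivative is [2 * tent d u]. *)
Definition ramp d u : R := sqpos u - 2 * sqpos (u - d) + sqpos (u - 2 * d).

(** The tent function of height d supported by [0, 2 d]. *)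
Definition tent d u : R :=
  Num.max u 0 - 2 * Num.max (u - d) 0 + Num.max (u - 2 * d) 0.

Lemma continuous_pos : continuous (fun u : R => Num.max u 0).
Proof.
by move=> x; apply: (@continuous_max _ _ id (cst 0));
  [exact: cvg_id|exact: cvg_cst].
Qed.

Lemma is_derive_sqpos x : is_derive x 1 sqpos (2 * Num.max x 0).
Proof.
have cvgq : h^-1 *: ((sqpos \o shift x) (h *: 1) - sqpos x) @[h --> 0^'] -->
    2 * Num.max x 0.
  apply/cvgrPdist_le => /= e e0; near=> h.
  have h0 : h != 0 by near: h; exact: nbhs_dnbhs_neq.
  have he : `|h| <= e.
    by near: h; apply: dnbhs0_le.
  apply: le_trans he.
  rewrite /GRing.scale/= mulr1 -(@ler_pM2r _ `|h|) ?normr_gt0// -normrM.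
  rewrite mulrBl [X in _ - X]mulrAC mulVf// mul1r -normrM -expr2.
  rewrite (ger0_norm (sqr_ge0 h)) /sqpos ler_norml.
  by rewrite /Order.max; case: (ltP x 0) => ?; case: (ltP (h + x) 0) => ?;
    apply/andP; split; nra.
by split; [apply/cvg_ex; eexists; exact: cvgq|exact/cvg_lim].
Unshelve. all: by end_near. Qed.

Lemma is_derive_ramp d x : is_derive x 1 (ramp d) (2 * tent d x).
Proof.
have sh c : is_derive x 1 (fun u => sqpos (u - c)) (2 * Num.max (x - c) 0).
  have hs : is_derive x 1 (fun u : R => u - c) 1.
    have := is_deriveB (is_derive_id x 1) (is_derive_cst c x 1).
    by rewrite subr0.
  have := @is_derive1_comp R sqpos (fun u => u - c) x _ _ (is_derive_sqpos (x - c)) hs.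
  by rewrite mulr1.
have h0 := is_derive_sqpos x.
have := is_deriveD (is_deriveB h0 (is_deriveZ 2 (sh d))) (sh (2 * d)).
congr (is_derive _ _ _ _); rewrite /tent /GRing.scale/=; ring.
Qed.

Lemma ramp_eq0 d u : 0 <= d -> u <= 0 -> ramp d u = 0.
Proof.
move=> d0 u0; rewrite /ramp /sqpos !max_r ?expr0n/= ?mulr0 ?subr0 ?addr0//; lra.
Qed.

Lemma ramp_end d u : 0 <= d -> 2 * d <= u -> ramp d u = 2 * d ^+ 2.
Proof.
by move=> d0 ud; rewrite /ramp /sqpos !max_l; [ring|lra..].
Qed.

Lemma tent_ge0 d u : 0 <= d -> 0 <= tent d u.
Proof.
move=> d0; rewrite /tent /Order.max.
by case: (ltP u 0) => ?; case: (ltP (u - d) 0) => ?;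
  case: (ltP (u - 2 * d) 0) => ?; lra.
Qed.

Lemma tent_eq0 d u : 0 <= d -> u \notin `[0, 2 * d] -> tent d u = 0.
Proof.
rewrite in_itv/= negb_and -!ltNge => d0 /orP[] h; rewrite /tent.
  by rewrite !max_r; [ring|lra..].
by rewrite !max_l; [ring|lra..].
Qed.

Lemma continuous_translate f c : continuous f -> continuous (fun u => f (u - c)).
Proof.
move=> cf u; apply: (@continuous_comp R R R (fun u => u - c) f u); last exact: cf.
by apply: cvgB; [exact: cvg_id|exact: cvg_cst].
Qed.

Lemma continuous_tent d : continuous (tent d).
Proof.
have sh c : continuous (fun u : R => Num.max (u - c) 0).
  exact: (@continuous_translate _ c continuous_pos).
move=> u; rewrite /tent; apply: cvgD; last exact: sh.
by apply: cvgB; [exact: continuous_pos|apply: cvgM; [exact: cvg_cst|exact: sh]].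
Qed.

(** A test function whose derivative is the difference of two tents of equal
    mass, to the right of [x] and of [y]. *)
Definition bump d x y : R -> R := fun t => ramp d (t - x) - ramp d (t - y).

Lemma is_derive_ramp_shift d c x :
  is_derive x 1 (fun t => ramp d (t - c)) (2 * tent d (x - c)).
Proof.
have hs : is_derive x 1 (fun u : R => u - c) 1.
  have := is_deriveB (is_derive_id x 1) (is_derive_cst c x 1).
  by rewrite subr0.
have := @is_derive1_comp R (ramp d) (fun u => u - c) x _ _
  (is_derive_ramp d (x - c)) hs.
by rewrite mulr1.
Qed.

Lemma derive1_bump d x y t :
  derive1 (bump d x y) t = 2 * tent d (t - x) - 2 * tent d (t - y).
Proof.
rewrite derive1E; apply: derive_val.
exact: is_deriveB (is_derive_ramp_shift d x t) (is_derive_ramp_shift d y t).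
Qed.

Lemma continuous_tent_shift d c : continuous (fun t => 2 * tent d (t - c)).
Proof.
move=> t; apply: cvgM; first exact: cvg_cst.
exact: (@continuous_translate _ c (@continuous_tent d) t).
Qed.

Lemma bump_test_function a d x y : 0 < x -> x <= y -> 0 <= d -> y + 2 * d < a ->
  test_function 0 a (bump d x y).
Proof.
move=> x0 xy d0 yda.
have supp : closure [set t | bump d x y t != 0] `<=` `[x, y + 2 * d].
  have /closure_id -> : closed (`[x, y + 2 * d]%classic : set R).
    exact: interval_closed.
  apply: closureS => t /=; apply: contraNT; rewrite in_itv/= negb_and -!ltNge.
  rewrite /bump => /orP[h|h].
    by rewrite !ramp_eq0 ?subrr//; lra.
  by rewrite !ramp_end ?subrr//; lra.
split.
- split.
    move=> t; apply: ex_derive.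
    exact: is_deriveB (is_derive_ramp_shift d x t) (is_derive_ramp_shift d y t).
  rewrite (_ : derive1 _ = fun t => 2 * tent d (t - x) - 2 * tent d (t - y)).
    by move=> t; apply: cvgB; exact: continuous_tent_shift.
  by apply/funext => t; exact: derive1_bump.
- apply: subclosed_compact supp; [exact: closed_closure|exact: segment_compact].
- move=> t /supp /=; rewrite !in_itv/= => /andP[xt ty].
  by rewrite (lt_le_trans x0 xt) (le_lt_trans ty).
Qed.

Lemma Rintegral_tent a d x : 0 <= x -> 0 <= d -> x + 2 * d <= a ->
  \int[mu]_(t in `[0, a]) (2 * tent d (t - x)) = 2 * d ^+ 2.
Proof.
move=> x0 d0 xda.
have E : derive1 (fun t => ramp d (t - x)) = fun t => 2 * tent d (t - x).
  by apply/funext => t; rewrite derive1E; apply: derive_val; exact: is_derive_ramp_shift.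
rewrite -E C1_FTC2.
- by rewrite ramp_end ?ramp_eq0 ?subr0//; lra.
- split; last by rewrite E; exact: continuous_tent_shift.
  by move=> t; apply: ex_derive; exact: is_derive_ramp_shift.
- lra.
Qed.

(** Averaging a continuous function against a narrow tent at [x] gives
    approximately its value at [x]. *)
Lemma tent_average a d x w e : 0 <= x -> 0 <= d -> x + 2 * d <= a ->
  {within `[0, a], continuous w} ->
  (forall u, u \in `[x, x + 2 * d] -> `|w u - w x| <= e) ->
  `|\int[mu]_(t in `[0, a]) (w t * (2 * tent d (t - x))) - w x * (2 * d ^+ 2)|
    <= e * (2 * d ^+ 2).
Proof.
move=> x0 d0 xda cw we.
have ct : {within `[0, a], continuous (fun t => 2 * tent d (t - x))}.
  by apply: continuous_subspaceT; exact: continuous_tent_shift.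
have it := continuous_itv_integrable ct.
have iw : mu.-integrable `[0, a] (EFin \o (fun t => w t * (2 * tent d (t - x)))).
  by apply: integrable_mul_continuous => //; exact: continuous_itv_integrable.
have iz (z : R) : mu.-integrable `[0, a]
    (EFin \o (fun t => z * (2 * tent d (t - x)))).
  exact: integrable_fctZ.
rewrite -(Rintegral_tent x0 d0 xda) -!RintegralZl// -RintegralB//.
have idf : mu.-integrable `[0, a] (EFin \o (fun t =>
    w t * (2 * tent d (t - x)) - w x * (2 * tent d (t - x)))).
  exact: integrable_fctB.
apply: (le_trans (le_normr_Rintegral _ idf)) => //.
apply: le_Rintegral => //; first exact: integrable_norm.
move=> t _; rewrite -mulrBl normrM (ger0_norm (_ : 0 <= 2 * _)) ?mulr_ge0 ?tent_ge0//.
have [tx|tx] := boolP (t - x \in `[0, 2 * d]).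
  rewrite ler_wpM2r ?mulr_ge0 ?tent_ge0// we//.
  by move: tx; rewrite !in_itv/= subr_ge0 lerBlDl.
by rewrite tent_eq0// !mulr0.
Qed.

(** The du Bois-Reymond lemma: a continuous function whose weak derivative
    vanishes is constant. Tested against [bump d x y], the hypothesis equates
    the averages of [w] near [x] and near [y]. *)
Lemma du_bois_reymond a w : 0 < a -> {within `[0, a], continuous w} ->
  (forall eta, test_function 0 a eta ->
    \int[mu]_(t in `]0, a[) (w t * derive1 eta t) = 0) ->
  forall t, t \in `[0, a] -> w t = w 0.
Proof.
move=> a0 cw w0.
have /(continuous_within_itvP _ a0) [cwo cw0 cwa] := cw.
have inner x y : 0 < x -> x < y -> y < a -> w x = w y.
  move=> x0 xy ya; apply/eqP; rewrite -subr_eq0 -normr_le0.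
  apply/ler_addgt0Pr => e e0; rewrite add0r.
  have e2 : 0 < e / 2 by rewrite divr_gt0.
  have nearw z : 0 < z -> z < a -> \forall d \near 0^'+,
      forall u, u \in `[z, z + 2 * d] -> `|w u - w z| <= e / 2.
    move=> z0 za.
    have /cvgrPdist_le /(_ _ e2) : w u @[u --> z] --> w z.
      by apply: cwo; rewrite in_itv/= z0 za.
    move=> -[r /= r0 rP]; near=> d => u; rewrite in_itv/= => /andP[zu uz].
    rewrite distrC; apply: rP; rewrite /= distrC ger0_norm ?subr_ge0//.
    rewrite ltrBlDl (le_lt_trans uz)// ltrD2l -ltr_pdivlMl//.
    by near: d; apply: nbhs_right_lt; rewrite mulr_gt0.
  near (0:R)^'+ => d.
  have d0 : 0 < d by [].
  have yda : y + 2 * d < a.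
    rewrite -ltrBrDl -ltr_pdivlMl//; near: d; apply: nbhs_right_lt.
    by rewrite mulr_gt0// subr_gt0.
  have xda : x + 2 * d < a by lra.
  have wx : forall u, u \in `[x, x + 2 * d] -> `|w u - w x| <= e / 2.
    by near: d; apply: nearw => //; exact: lt_trans ya.
  have wy : forall u, u \in `[y, y + 2 * d] -> `|w u - w y| <= e / 2.
    by near: d; apply: nearw => //; exact: lt_trans xy.
  have Ix := tent_average (ltW x0) (ltW d0) (ltW xda) cw wx.
  have Iy := tent_average (ltW (lt_trans x0 xy)) (ltW d0) (ltW yda) cw wy.
  have := w0 _ (bump_test_function x0 (ltW xy) (ltW d0) yda).
  have icw c : mu.-integrable `[0, a] (EFin \o (fun t => w t * (2 * tent d (t - c)))).
    apply: integrable_mul_continuous; last exact: continuous_itv_integrable.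
    by apply: continuous_subspaceT; exact: continuous_tent_shift.
  have wE : (fun t => w t * derive1 (bump d x y) t) =
      (fun t => w t * (2 * tent d (t - x)) - w t * (2 * tent d (t - y))).
    by apply/funext => t; rewrite derive1_bump mulrBr.
  rewrite wE Rintegral_oo_cc; last exact: integrable_fctB.
  rewrite RintegralB// => /eqP; rewrite subr_eq0 => /eqP IE.
  rewrite IE in Ix.
  move: Ix Iy; set I := \int[mu]_(t in _) _ => Ix Iy.
  have D0 : 0 < 2 * d ^+ 2 by rewrite mulr_gt0// exprn_gt0.
  rewrite -(ler_pM2r D0) -{1}(gtr0_norm D0) -normrM.
  rewrite (_ : (w x - w y) * (2 * d ^+ 2) =
    (I - w y * (2 * d ^+ 2)) - (I - w x * (2 * d ^+ 2))); last by ring.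
  apply: (le_trans (ler_normB _ _)); apply: le_trans (lerD Iy Ix) _.
  by rewrite -mulrDl -splitr.
have w_half t : 0 < t -> t < a -> w t = w (a / 2).
  have a2 : 0 < a / 2 by rewrite divr_gt0.
  have a2a : a / 2 < a by lra.
  move=> t0 ta; case: (ltgtP t (a / 2)) => [h|h|->//]; first exact: inner.
  by apply/esym; exact: inner.
have wl : w 0 = w (a / 2).
  have : w t @[t --> 0^'+] --> w (a / 2).
    apply: cvg_near_cst; near=> t; apply: w_half => //.
  by move=> /(cvg_unique _ cw0) ->.
have wr : w a = w (a / 2).
  have : w t @[t --> a^'-] --> w (a / 2).
    apply: cvg_near_cst; near=> t; apply: w_half => //.
  by move=> /(cvg_unique _ cwa) ->.
move=> t; rewrite in_itv/= => /andP[]; rewrite !le_eqVlt.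
move=> /predU1P[<-//|t0] /predU1P[->|ta]; first by rewrite wr wl.
by rewrite w_half// wl.
Unshelve. all: by end_near. Qed.

End du_bois_reymond.

(** * Curves of class H^1 and their velocities *)

Section euclidean_norm.
Context {R : realType} {m : nat}.
Implicit Types x : 'rV[R]_m.

Lemma eucl_norm_ge0 x : 0 <= eucl_norm x.
Proof. exact: sqrtr_ge0. Qed.

Lemma sqr_eucl_norm x : eucl_norm x ^+ 2 = \sum_(i < m) x ord0 i ^+ 2.
Proof. by rewrite sqr_sqrtr// sumr_ge0// => i _; exact: sqr_ge0. Qed.

Lemma eucl_normZ k x : eucl_norm (k *: x) = `|k| * eucl_norm x.
Proof.
rewrite /eucl_norm -sqrtr_sqr -sqrtrM ?sqr_ge0//; congr Num.sqrt.
by rewrite mulr_sumr; apply: eq_bigr => i _; rewrite mxE exprMn.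
Qed.

Lemma measurable_eucl_norm d (T : measurableType d) (D : set T)
    (w : T -> 'rV[R]_m) :
  (forall i, measurable_fun D (fun t => w t ord0 i)) ->
  measurable_fun D (fun t => eucl_norm (w t)).
Proof.
move=> mw; apply: (@measurableT_comp _ _ _ _ _ _ (@Num.sqrt R)).
  by apply: continuous_measurable_fun; exact: sqrt_continuous.
by apply: measurable_sum => i; exact: measurable_funX.
Qed.

End euclidean_norm.

Section velocity.
Context {R : realType}.
Notation mu := (@lebesgue_measure R).
Implicit Types (a b s t : R) (f g : R -> R).

Lemma integrable_oo_cc a b f : mu.-integrable `]a, b[ (EFin \o f) ->
  mu.-integrable `[a, b] (EFin \o f).
Proof.
move=> /integrableP[mf fi]; apply/integrableP; split.
  exact: emeasurable_fun_itv_cc mf.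
by rewrite integral_itv_bndoo//; exact: measurableT_comp.
Qed.

Lemma square_integrable_integrable a b f : measurable_fun `[a, b] f ->
  mu.-integrable `[a, b] (fun t => (f t ^+ 2)%:E) ->
  mu.-integrable `[a, b] (EFin \o f).
Proof.
move=> mf f2.
have f21 : mu.-integrable `[a, b] (EFin \o (fun t => 1 + f t ^+ 2)).
  by apply: integrable_fctD => //; exact: cst_itv_integrable.
apply: le_integrable f21 => //; first exact/measurable_EFinP.
move=> x _ /=; rewrite lee_fin (ger0_norm (_ : 0 <= 1 + _)) ?addr_ge0 ?sqr_ge0//.
by rewrite ler_norml; apply/andP; split; nra.
Qed.

(** [w] is a velocity on [0, a] of the curve [q] of class H^1: a measurable
    and square integrable function of which [q] is a primitive. This form of
    weak differentiability is the one that changes of parameter preserve. *)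
Definition velocity (m : nat) a (q w : R -> 'rV[R]_m) : Prop :=
  [/\ {within `[0, a], continuous q},
      forall i, measurable_fun `[0, a] (fun t => w t ord0 i),
      forall i, mu.-integrable `[0, a] (fun t => (w t ord0 i ^+ 2)%:E) &
      forall i t, t \in `[0, a] ->
        q t ord0 i = q 0 ord0 i + \int[mu]_(x in `[0, t]) w x ord0 i].

Section velocity_theory.
Variable m : nat.
Implicit Types q w : R -> 'rV[R]_m.

Lemma velocity_integrable a q w i : velocity a q w ->
  mu.-integrable `[0, a] (EFin \o (fun t => w t ord0 i)).
Proof. by move=> [_ mw w2 _]; exact: square_integrable_integrable. Qed.

Lemma within_continuous_compr (T U : topologicalType) (D : set R) (f : R -> T)
    (K : T -> U) : {within D, continuous f} -> continuous K ->
  {within D, continuous (fun t => K (f t))}.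
Proof.
move=> cf cK x; apply: (@continuous_comp (subspace D) T U f K x); first exact: cf.
exact: cK.
Qed.

Lemma continuous_coord a q i : {within `[0, a], continuous q} ->
  {within `[0, a], continuous (fun t => q t ord0 i)}.
Proof.
move=> cq; apply: (@within_continuous_compr _ _ _ q (fun x => x ord0 i)) => //.
exact: coord_continuous.
Qed.

Lemma velocity_weak_deriv a q w : 0 <= a -> velocity a q w ->
  is_weak_deriv 0 a q w.
Proof.
move=> a0 vel i; have [cq mw w2 qw] := vel.
have sub : `]0, a[ `<=` `[0, a] by exact: subset_itv_oo_cc.
split; first split.
- exact: measurable_funS (mw i).
- exact: integrableS (w2 i).
- move=> eta teta; apply: (primitive_by_parts a0 _ _ _ teta).
  + exact: continuous_coord.
  + exact: velocity_integrable vel.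
  + exact: qw.
Qed.

Lemma velocity_H1 a q w : 0 <= a -> velocity a q w -> H1 0 a q.
Proof.
move=> a0 vel; split; first by case: vel.
by exists w; exact: velocity_weak_deriv.
Qed.

(** A continuous curve differs from the primitive of its weak derivative by a
    function with zero weak derivative, hence by a constant. *)
Lemma weak_deriv_velocity a q w : 0 < a -> {within `[0, a], continuous q} ->
  is_weak_deriv 0 a q w -> velocity a q w.
Proof.
move=> a0 cq qw.
have mw i : measurable_fun `[0, a] (fun t => w t ord0 i).
  by apply: measurable_fun_itv_cc; exact: (qw i).1.1.
have w2 i : mu.-integrable `[0, a] (fun t => (w t ord0 i ^+ 2)%:E).
  by apply: (@integrable_oo_cc 0 a (fun t => w t ord0 i ^+ 2)); exact: (qw i).1.2.
split => // i t ta.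
have iw : mu.-integrable `[0, a] (EFin \o (fun t => w t ord0 i)).
  exact: square_integrable_integrable.
pose P t := \int[mu]_(x in `[0, t]) w x ord0 i.
have cP : {within `[0, a], continuous P}.
  exact: (parameterized_integral_continuous (ltW a0) iw).
have cqi := continuous_coord (i := i) cq.
have cd : {within `[0, a], continuous (fun t => q t ord0 i - P t)}.
  by move=> x; apply: cvgB; [exact: cqi|exact: cP].
have -> : q t ord0 i = (q t ord0 i - P t) + P t by rewrite subrK.
rewrite (@du_bois_reymond _ a (fun t => q t ord0 i - P t))//; last first.
  move=> eta teta; have [C1eta _ _] := teta.
  have cD : {within `[0, a], continuous (derive1 eta)}.
    exact: continuous_subspaceT C1eta.2.
  have i1 : mu.-integrable `[0, a] (EFin \o (fun t => q t ord0 i * derive1 eta t)).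
    by apply: integrable_mul_continuous => //; exact: continuous_itv_integrable.
  have i2 : mu.-integrable `[0, a] (EFin \o (fun t => P t * derive1 eta t)).
    by apply: integrable_mul_continuous => //; exact: continuous_itv_integrable.
  have sub : `]0, a[ `<=` `[0, a] by exact: subset_itv_oo_cc.
  under eq_Rintegral do rewrite mulrBl.
  rewrite RintegralB//; [|exact: integrableS i1|exact: integrableS i2].
  rewrite (qw i).2// (@primitive_by_parts _ a P (fun t => w t ord0 i))//.
  - by rewrite subrr.
  - exact: ltW.
  - by move=> x xa; rewrite /P Rintegral_itv00 add0r.
by rewrite /P Rintegral_itv00 subr0.
Qed.

Lemma H1_velocity a q : 0 < a -> H1 0 a q -> velocity a q (weak_deriv 0 a q).
Proof.
move=> a0 [cq qw]; apply: weak_deriv_velocity => //.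
exact: (@xgetPex _ _ [set v | is_weak_deriv 0 a q v]).
Qed.

Lemma ae_forall_ord (P : 'I_m -> R -> Prop) :
  (forall i, {ae mu, forall t, P i t}) -> {ae mu, forall t, forall i, P i t}.
Proof.
move=> aeP.
have : {ae mu, forall t, forall n (i : 'I_m), i = n :> nat -> P i t}.
  apply: ae_foralln => n; have [nm|mn] := ltnP n m; last first.
    by apply: aeW => t i iE; have := ltn_ord i; rewrite iE ltnNge mn.
  apply: ae_imply (aeP (Ordinal nm)) => t Pt i iE.
  by rewrite (_ : i = Ordinal nm)//; exact: val_inj.
by apply: ae_imply => t h i; exact: (h i).
Qed.

Lemma velocity_unique a q w1 w2 : velocity a q w1 -> velocity a q w2 ->
  {ae mu, forall t, t \in `[0, a] -> w1 t = w2 t}.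
Proof.
move=> v1 v2.
have : {ae mu, forall t, forall i, t \in `[0, a] -> w1 t ord0 i = w2 t ord0 i}.
  apply: ae_forall_ord => i; apply: primitive_ae_inj.
  - exact: velocity_integrable v1.
  - exact: velocity_integrable v2.
  - move=> t ta; have [_ _ _ q1] := v1; have [_ _ _ q2] := v2.
    by apply: (@addrI _ (q 0 ord0 i)); rewrite -q1// q2.
by apply: ae_imply => t h ta; apply/rowP => i; exact: h.
Qed.

Lemma velocity_weak_deriv_ae a q w : 0 < a -> velocity a q w ->
  {ae mu, forall t, t \in `[0, a] -> weak_deriv 0 a q t = w t}.
Proof.
move=> a0 vel; apply: (velocity_unique _ vel).
by apply: H1_velocity => //; exact: velocity_H1 (ltW a0) vel.
Qed.

End velocity_theory.
End velocity.

(** * Reparametrised curves *)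

Section reparametrisation.
Context {R : realType}.
Notation mu := (@lebesgue_measure R).
Implicit Types (a b c s t x : R) (f g h sigma : R -> R).

Lemma continuous_comp_within (T : topologicalType) (D : set R) (q : R -> T)
    sigma :
  {within D, continuous q} -> continuous sigma -> (forall t, D (sigma t)) ->
  continuous (fun t => q (sigma t)).
Proof.
move=> /subspace_continuousP cq cs Ds t B /(cq _ (Ds t)) /= nB.
have := cs t _ nB; rewrite /= nbhs_filterE /fmap /=.
by apply: filterS => u /=; apply.
Qed.

(** The two conventions for zero agree: 0 `^ (-1) = 0 = 0^-1. *)
Lemma measurable_invr d (T : measurableType d) (D : set T) (f : T -> R) :
  (forall z, D z -> 0 <= f z) -> measurable_fun D f ->
  measurable_fun D (fun z => (f z)^-1).
Proof.
move=> f0 mf; apply: (@eq_measurable_fun _ _ _ _ _ (fun z => powR (f z) (-1))).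
  by move=> x /set_mem Dx; rewrite powR_inv1// f0.
apply: (@measurableT_comp _ _ _ _ _ _ (fun r : R => powR r (-1))) mf.
exact: measurable_powR.
Qed.

Lemma ae_eq_Rintegral a f g : measurable_fun `[0, a] f ->
  measurable_fun `[0, a] g -> {ae mu, forall t, t \in `[0, a] -> f t = g t} ->
  \int[mu]_(t in `[0, a]) f t = \int[mu]_(t in `[0, a]) g t.
Proof.
move=> mf mg fg; congr fine; apply: ae_eq_integral => //.
- exact/measurable_EFinP.
- exact/measurable_EFinP.
- by apply: ae_imply fg => t h ta; rewrite h.
Qed.

(** A primitive on [0, b] of a continuous function extends to a C^1 function
    on the line: extend the function by constants. *)
Lemma C1_on_clock b f : 0 <= b -> {within `[0, b], continuous f} ->
  C1_on `[0, b] (clock f).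
Proof.
move=> b0 cf.
pose clamp t := Num.max 0 (Num.min t b).
have cclamp : continuous clamp.
  move=> t; apply: (@continuous_max _ _ (cst 0) (fun t => Num.min t b)).
    exact: cvg_cst.
  by apply: (@continuous_min _ _ id (cst b)); [exact: cvg_id|exact: cvg_cst].
have clampP t : `[0, b]%classic (clamp t).
  by rewrite /= in_itv/= /clamp le_max lexx/= ge_max b0 ge_min lexx orbT.
have clampE t : t \in `[0, b] -> clamp t = t.
  by rewrite in_itv/= => /andP[t0 tb]; rewrite /clamp min_l// max_r.
(* As [k] vanishes on the negative half-line, it has a primitive given by a
   single formula on the whole line. *)
pose k t := f (clamp t) - f 0.
have ck : continuous k.
  move=> t; apply: cvgB; last exact: cvg_cst.
  exact: (continuous_comp_within cf cclamp).
have k0 t : t <= 0 -> k t = 0.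
  move=> t0; rewrite /k /clamp max_l ?subrr//.
  by rewrite ge_min t0.
have mkcond u : \int[mu]_(t in `]-oo, u]) k t = \int[mu]_(t in `[0, u]) k t.
  rewrite [LHS]Rintegral_mkcond [RHS]Rintegral_mkcond.
  apply: eq_Rintegral => t _; rewrite !patchE !mem_setE !in_itv/=.
  by case: (leP 0 t) => //= t0; rewrite k0 ?if_same// ltW.
have ik u : mu.-integrable `]-oo, u] (EFin \o k).
  have i1 : mu.-integrable `[0, u] (EFin \o k).
    by apply: continuous_itv_integrable; exact: continuous_subspaceT.
  have : mu.-integrable (`]-oo, u] `&` `[0, u]) (EFin \o k).
    by apply: integrableS i1 => //; exact: measurableI.
  move=> /integrable_restrict i2.
  have : mu.-integrable `]-oo, u] ((EFin \o k) \_ `[0, u]) by exact: i2.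
  apply: eq_integrable => // t; rewrite !patchE !mem_setE !in_itv/= => ->.
  by rewrite andbT; case: (leP 0 t) => //= t0; rewrite k0// ltW.
pose G x := \int[mu]_(t in `]-oo, x]) k t.
have dG x : is_derive x 1 G (k x).
  have [dGx GE] : derivable G x 1 /\ derive1 G x = k x.
    apply: (@continuous_FTC1 R k -oo%O x (x + 1)) => //.
    - by rewrite ltrDl.
    - by rewrite ltNyr.
    - exact: ck.
  split; first exact: dGx.
  by rewrite -derive1E; exact: GE.
pose F x := f 0 * x + G x.
have dF x : is_derive x 1 F (f (clamp x)).
  have := is_deriveD (is_deriveZ (f 0) (is_derive_id x 1)) (dG x).
  by congr (is_derive _ _ _ _); rewrite /GRing.scale/= mulr1 /k addrCA subrr addr0.
exists F.
  split; first by move=> x; exact: ex_derive.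
  rewrite (_ : derive1 F = fun x => f (clamp x)).
    exact: (continuous_comp_within cf cclamp).
  by apply/funext => x; rewrite derive1E; exact: derive_val.
move=> s; rewrite inE/= => sb; rewrite /F /G mkcond /clock.
have := sb; rewrite in_itv/= => /andP[s0 s1].
have cfs : mu.-integrable `[0, s] (EFin \o f).
  exact: integrable_subitv (continuous_itv_integrable cf).
have -> : \int[mu]_(t in `[0, s]) k t = \int[mu]_(t in `[0, s]) (f t - f 0).
  apply: eq_Rintegral => t; rewrite mem_setE in_itv/= => /andP[t0 ts].
  by rewrite /k clampE// in_itv/= t0 (le_trans ts).
rewrite RintegralB//; last exact: cst_itv_integrable.
by rewrite Rintegral_itv_cst// subr0 addrC subrK.
Qed.

Lemma diffeo_sym a b c d psi phi :
  diffeo a b c d psi phi -> @diffeo R c d a b phi psi.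
Proof. by move=> [[? ? ? ?] [? ?]]. Qed.

Section time_change.
Variables (a b : R) (h sigma : R -> R).
Hypotheses (a0 : 0 < a) (tc : time_change a b h sigma).

Let h_gt0 s : s \in `[0, a] -> 0 < h s.
Proof. by move=> sa; exact: (rate_gt0 tc sa). Qed.

Let mh : measurable_fun `[0, a] h.
Proof. by have [[]] := tc. Qed.

Let mhV : measurable_fun `[0, a] (fun s => (h s)^-1).
Proof. by apply: measurable_invr => // x /h_gt0/ltW. Qed.

Let b0 : 0 < b. Proof. exact: (time_change_gt0 a0 tc). Qed.

(** The inverse of a change of parameter is again a primitive; it is of class
    C^1 as soon as the rate is continuous. *)
Lemma time_change_primitive t : t \in `[0, b] ->
  sigma t = clock (fun t => (h (sigma t))^-1) t.
Proof.
have [_ [_ sa _ _]] := tc.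
move=> tb; rewrite /clock.
rewrite (@Rintegral_substitution_upto _ _ _ _ _ a0 tc (fun s => (h s)^-1))//.
have := sa t; rewrite in_itv/= => /andP[s0 s1].
transitivity (\int[mu]_(s in `[0, sigma t]) (1 : R)).
  by rewrite Rintegral_itv_cst// subr0 mul1r.
apply: eq_Rintegral => s; rewrite mem_setE in_itv/= => /andP[s0' s1'].
by rewrite mulVf// gt_eqF// h_gt0// in_itv/= s0' (le_trans s1').
Qed.

Lemma time_change_diffeo : {within `[0, a], continuous h} ->
  diffeo 0 a 0 b (clock h) sigma.
Proof.
move=> ch; have [_ [cs sa sK Ks]] := tc.
split; first split => //.
- by move=> s; exact: (clock_itv a0 tc).
- split; first exact: C1_on_clock (ltW a0) ch.
  have [|F C1F FE] := @C1_on_clock b (fun t => (h (sigma t))^-1) (ltW b0).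
    apply: continuous_subspaceT => t; apply: cvgV.
      by rewrite gt_eqF// h_gt0.
    exact: (continuous_comp_within ch cs).
  exists F => // t tb; rewrite -FE//; apply: time_change_primitive.
  by move: tb; rewrite inE.
Qed.

Variables (m : nat) (q w : R -> 'rV[R]_m).
Hypothesis vel : velocity a q w.

Lemma velocity_time_change :
  velocity b (q \o sigma) (fun t => (h (sigma t))^-1 *: w (sigma t)).
Proof.
have [cq mw w2 qw] := vel; have [rh [cs sa sK Ks]] := tc.
have [_ [c c0 hc] hi _] := rh.
have mf i : measurable_fun `[0, a] (fun s => (h s)^-1 * w s ord0 i).
  exact: measurable_funM.
have coordE i t : ((h (sigma t))^-1 *: w (sigma t)) ord0 i =
    (fun s => (h s)^-1 * w s ord0 i) (sigma t) by rewrite mxE.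
split.
- by apply: continuous_subspaceT; exact: (continuous_comp_within cq cs).
- move=> i; have := measurable_time_change tc (mf i).
  by apply: eq_measurable_fun => t _; rewrite /= coordE.
- move=> i; suff : mu.-integrable `[0, b] (EFin \o
      ((fun s => ((h s)^-1 * w s ord0 i) ^+ 2) \o sigma)).
    by apply: eq_integrable => // t _; rewrite /= coordE.
  apply: (@integrable_substitution _ _ _ _ _ a0 tc
    (fun s => ((h s)^-1 * w s ord0 i) ^+ 2)).
    exact: measurable_funX.
  have w2c : mu.-integrable `[0, a]
      (fun s => (c^-1)%:E * (w s ord0 i ^+ 2)%:E)%E.
    exact: integrableZl.
  apply: le_integrable w2c => //.
    apply/measurable_EFinP; apply: measurable_funM => //.
    by apply: measurable_funX; exact: mf.
  move=> s /= sin; rewrite lee_fin.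
  have hs := h_gt0 sin; have hcs := hc _ sin.
  rewrite ger0_norm; last by rewrite mulr_ge0 ?sqr_ge0// ltW.
  rewrite ger0_norm; last by rewrite mulr_ge0 ?sqr_ge0// invr_ge0 ltW.
  have -> : ((h s)^-1 * w s ord0 i) ^+ 2 * h s = (h s)^-1 * w s ord0 i ^+ 2.
    by field; rewrite gt_eqF.
  by rewrite ler_wpM2r ?sqr_ge0// lef_pV2.
- move=> i t tb; rewrite /= (time_change0 a0 tc).
  have := sa t; rewrite in_itv/= => /andP[s0 s1].
  under eq_Rintegral do rewrite coordE.
  rewrite (Rintegral_substitution_upto a0 tc (mf i) tb) qw//; congr (_ + _).
  apply: eq_Rintegral => s; rewrite mem_setE in_itv/= => /andP[s0' s1'].
  by rewrite mulrAC mulVf ?mul1r// gt_eqF// h_gt0// in_itv/= s0' (le_trans s1').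
Qed.

Lemma weak_deriv_time_change : {ae mu, forall t, t \in `[0, b] ->
  weak_deriv 0 b (q \o sigma) t = (h (sigma t))^-1 *: w (sigma t)}.
Proof. exact: (velocity_weak_deriv_ae b0 velocity_time_change). Qed.

End time_change.
End reparametrisation.

(** * Functionals of a curve and of its velocity *)

Section functionals.
Context {R : realType}.
Notation mu := (@lebesgue_measure R).
Implicit Types (a b c s t x : R) (f g h sigma : R -> R).

Lemma ae_le_Rintegral a f g :
  mu.-integrable `[0, a] (EFin \o f) -> mu.-integrable `[0, a] (EFin \o g) ->
  {ae mu, forall t, t \in `[0, a] -> f t <= g t} ->
  \int[mu]_(t in `[0, a]) f t <= \int[mu]_(t in `[0, a]) g t.
Proof.
move=> fi gi fg; rewrite -subr_ge0 -RintegralB//.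
have mgf : measurable_fun `[0, a] (fun t => g t - f t).
  apply: measurable_funB; apply/measurable_EFinP.
    exact: measurable_int gi.
  exact: measurable_int fi.
rewrite (@ae_eq_Rintegral _ a _ (fun t => Num.max (g t - f t) 0))//.
- by apply: Rintegral_ge0 => t _; rewrite le_max lexx orbT.
- exact: measurable_maxr.
- by apply: ae_imply fg => t h ta; rewrite max_l// subr_ge0 h.
Qed.

(** The Cauchy-Schwarz inequality against 1 on [0, 1], in the form of the
    variance identity. *)
Lemma Rintegral01_variance f : mu.-integrable `[0, 1] (EFin \o f) ->
  mu.-integrable `[0, 1] (EFin \o (fun t => f t ^+ 2)) ->
  \int[mu]_(t in `[0, 1]) (f t - \int[mu]_(x in `[0, 1]) f x) ^+ 2 =
  \int[mu]_(t in `[0, 1]) (f t ^+ 2) - (\int[mu]_(t in `[0, 1]) f t) ^+ 2.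
Proof.
move=> fi f2; set J := \int[mu]_(x in _) f x.
have i1 : mu.-integrable `[0, 1] (EFin \o (fun t => 2 * J * f t - J ^+ 2)).
  by apply: integrable_fctB => //; [exact: integrable_fctZ|exact: cst_itv_integrable].
transitivity (\int[mu]_(t in `[0, 1]) (f t ^+ 2 - (2 * J * f t - J ^+ 2))).
  by apply: eq_Rintegral => t _; ring.
rewrite RintegralB// RintegralB//; [|exact: integrable_fctZ|exact: cst_itv_integrable].
rewrite RintegralZl// Rintegral_itv_cst// -/J; ring.
Qed.

Lemma Rintegral01_sqr_le f : mu.-integrable `[0, 1] (EFin \o f) ->
  mu.-integrable `[0, 1] (EFin \o (fun t => f t ^+ 2)) ->
  (\int[mu]_(t in `[0, 1]) f t) ^+ 2 <= \int[mu]_(t in `[0, 1]) (f t ^+ 2).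
Proof.
move=> fi f2; rewrite -subr_ge0 -Rintegral01_variance//.
by apply: Rintegral_ge0 => t _; exact: sqr_ge0.
Qed.

(** In the case of equality the function is constant. *)
Lemma Rintegral01_sqr_eq f : mu.-integrable `[0, 1] (EFin \o f) ->
  mu.-integrable `[0, 1] (EFin \o (fun t => f t ^+ 2)) ->
  \int[mu]_(t in `[0, 1]) (f t ^+ 2) <= (\int[mu]_(t in `[0, 1]) f t) ^+ 2 ->
  {ae mu, forall t, t \in `[0, 1] -> f t = \int[mu]_(x in `[0, 1]) f x}.
Proof.
move=> fi f2 le; set J := \int[mu]_(x in _) f x.
have vi : mu.-integrable `[0, 1] (EFin \o (fun t => (f t - J) ^+ 2)).
  have : mu.-integrable `[0, 1]
      (EFin \o (fun t => f t ^+ 2 - (2 * J * f t - J ^+ 2))).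
    apply: integrable_fctB => //; apply: integrable_fctB => //.
      exact: integrable_fctZ.
    exact: cst_itv_integrable.
  by apply: eq_integrable => // t _ /=; congr EFin; ring.
have v0 : (\int[mu]_(t in `[0%R, 1%R]) `|((f t - J) ^+ 2)%:E| = 0)%E.
  transitivity (\int[mu]_(t in `[0%R, 1%R]) ((f t - J) ^+ 2)%:E)%E.
    by apply: eq_integral => t _; rewrite gee0_abs// lee_fin sqr_ge0.
  rewrite -[LHS]fineK; last exact: integrable_fin_num.
  congr EFin; rewrite -[LHS]/(\int[mu]_(t in `[0, 1]) ((f t - J) ^+ 2)).
  apply/eqP; rewrite eq_le Rintegral_ge0 ?andbT => [|t _]; last exact: sqr_ge0.
  by rewrite Rintegral01_variance// subr_le0.
have mv := measurable_int mu vi.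
have [|+ _] := @ae_eq_integral_abs _ _ _ mu _ _ _ mv; first exact: measurable_itv.
move=> /(_ v0).
apply: ae_imply => t h ta; apply/eqP; rewrite -subr_eq0 -sqrf_eq0.
by have [->] := h ta.
Qed.

Variables (m : nat).
Implicit Types q w : R -> 'rV[R]_m.

Lemma measurable_along a q w (K : 'rV[R]_m -> R) : velocity a q w ->
  continuous K -> measurable_fun `[0, a] (fun t => K (q t)).
Proof.
move=> [cq _ _ _] cK; apply: subspace_continuous_measurable_fun => //.
exact: (within_continuous_compr cq).
Qed.

Lemma measurable_speed a q w : velocity a q w ->
  measurable_fun `[0, a] (fun t => eucl_norm (w t)).
Proof. by move=> [_ mw _ _]; exact: measurable_eucl_norm. Qed.

Lemma integrable_sqr_speed a q w : velocity a q w ->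
  mu.-integrable `[0, a] (EFin \o (fun t => eucl_norm (w t) ^+ 2)).
Proof.
move=> [_ _ w2 _].
have : mu.-integrable `[0, a]
    (fun t => \sum_(i <- index_enum 'I_m) (w t ord0 i ^+ 2)%:E)%E.
  by apply: integrable_sum => // i _; exact: w2.
by apply: eq_integrable => // t _; rewrite /= sumEFin sqr_eucl_norm.
Qed.

Lemma integrable_speed a q w : velocity a q w ->
  mu.-integrable `[0, a] (EFin \o (fun t => eucl_norm (w t))).
Proof.
move=> vel; apply: square_integrable_integrable; first exact: measurable_speed vel.
exact: integrable_sqr_speed vel.
Qed.

Lemma integrable_along_mul a q w (K : 'rV[R]_m -> R) f : velocity a q w ->
  continuous K -> mu.-integrable `[0, a] (EFin \o f) ->
  mu.-integrable `[0, a] (EFin \o (fun t => K (q t) * f t)).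
Proof.
move=> [cq _ _ _] cK fi.
have : mu.-integrable `[0, a] (EFin \o (fun t => f t * K (q t))).
  by apply: integrable_mul_continuous => //; exact: (within_continuous_compr cq).
by apply: eq_integrable => // t _; rewrite /= mulrC.
Qed.

Lemma integrable_sqr_speed_rate a b h q w : 0 < a -> velocity a q w ->
  rate a b h ->
  mu.-integrable `[0, a] (EFin \o (fun t => eucl_norm (w t) ^+ 2 / h t)).
Proof.
move=> a0 vel [mh [c c0 hc] _ _].
have : mu.-integrable `[0, a] (EFin \o (fun t => c^-1 * eucl_norm (w t) ^+ 2)).
  by apply: integrable_fctZ => //; exact: integrable_sqr_speed vel.
apply: le_integrable => //.
  apply/measurable_EFinP; apply: measurable_funM.
    by apply: measurable_funX; exact: measurable_speed vel.
  by apply: measurable_invr => // x /hc /(lt_le_trans c0)/ltW.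
move=> t /= ta; have hct := hc _ ta; have h0 := lt_le_trans c0 hct.
rewrite lee_fin ger0_norm; last by rewrite mulr_ge0 ?sqr_ge0// invr_ge0 ltW.
rewrite ger0_norm; last by rewrite mulr_ge0 ?sqr_ge0// invr_ge0 ltW.
by rewrite [leRHS]mulrC ler_wpM2l ?sqr_ge0// lef_pV2.
Qed.

(** The effect of a change of parameter on a functional whose integrand is
    the sum of a term quadratic in the velocity and of a potential. *)
Lemma functional_time_change a b h sigma q w (K L : 'rV[R]_m -> R) : 0 < a ->
  time_change a b h sigma -> velocity a q w -> continuous K -> continuous L ->
  \int[mu]_(t in `[0, b]) (K (q (sigma t)) *
    eucl_norm (weak_deriv 0 b (q \o sigma) t) ^+ 2 + L (q (sigma t))) =
  \int[mu]_(s in `[0, a]) (K (q s) * (eucl_norm (w s) ^+ 2 / h s) + L (q s) * h s).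
Proof.
move=> a0 tc vel cK cL.
have b0 := time_change_gt0 a0 tc.
have velb := velocity_time_change a0 tc vel.
have velb' := H1_velocity b0 (velocity_H1 (ltW b0) velb).
have [[mh _ _ _] _] := tc.
have mhV : measurable_fun `[0, a] (fun s => (h s)^-1).
  by apply: measurable_invr => // s sa; exact: ltW (rate_gt0 tc sa).
have mn : measurable_fun `[0, a] (fun s => eucl_norm ((h s)^-1 *: w s)).
  apply: measurable_eucl_norm => i.
  have [_ mw _ _] := vel; have := measurable_funM mhV (mw i).
  by apply: eq_measurable_fun => s _; rewrite mxE.
pose f s := K (q s) * eucl_norm ((h s)^-1 *: w s) ^+ 2 + L (q s).
have mf : measurable_fun `[0, a] f.
  apply: measurable_funD; last exact: measurable_along vel cL.
  apply: measurable_funM; first exact: measurable_along vel cK.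
  exact: measurable_funX.
transitivity (\int[mu]_(t in `[0, b]) f (sigma t)).
  apply: ae_eq_Rintegral.
  - apply: measurable_funD; last exact: measurable_along velb' cL.
    apply: measurable_funM; first exact: measurable_along velb' cK.
    by apply: measurable_funX; exact: measurable_speed velb'.
  - exact: (measurable_time_change tc mf).
  - by apply: ae_imply (weak_deriv_time_change a0 tc vel) => t e tb; rewrite e.
rewrite (Rintegral_substitution a0 tc mf); apply: eq_Rintegral => s.
rewrite mem_setE => sa; have h0 := rate_gt0 tc sa.
rewrite /f eucl_normZ ger0_norm ?invr_ge0 ?ltW//.
by field; rewrite gt_eqF.
Qed.

End functionals.

(** * The action, the Jacobi functional and the Jacobi length *)

Section maupertuis.
Context {R : realType} {m : nat}.
Notation mu := (@lebesgue_measure R).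
Variables (V : 'rV[R]_m -> R) (eps : R) (qa qb : 'rV[R]_m).
Hypothesis cV : continuous V.
Implicit Types (a b t s T E : R) (h sigma : R -> R) (q w gamma : R -> 'rV[R]_m).

Let U x := V (eps^-1 *: x).

Let cU : continuous U.
Proof.
by move=> x; apply: (@continuous_comp 'rV[R]_m 'rV[R]_m R (fun x => eps^-1 *: x) V x);
  [exact: scaler_continuous|exact: cV].
Qed.

Let cNU : continuous (fun x => - U x).
Proof. by move=> x; apply: (@continuousN _ _ _ U); exact: cU. Qed.

(** [gap E x] is the square of the speed at [x] of a motion of energy [E];
    [jspeed E x] is that speed, the conformal factor of the Jacobi metric. It
    is 0 at the points that such a motion cannot reach. *)
Definition gap E x : R := 2 * (E - U x).
Definition jspeed E x : R := Num.sqrt (gap E x).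

(** The length of a curve for the Jacobi metric. *)
Definition jlength E a q : R :=
  \int[mu]_(t in `[0, a]) (jspeed E (q t) * eucl_norm (weak_deriv 0 a q t)).

Lemma continuous_gap E : continuous (gap E).
Proof.
move=> x; apply: (@continuousM _ _ (fun=> 2) (fun x => E - U x)).
  exact: cst_continuous.
by apply: (@continuousB _ _ _ (fun=> E) U); [exact: cst_continuous|exact: cU].
Qed.

Lemma continuous_jspeed E : continuous (jspeed E).
Proof.
move=> x; apply: (@continuous_comp 'rV[R]_m R R (gap E) (@Num.sqrt R) x).
  exact: continuous_gap.
exact: sqrt_continuous.
Qed.

Lemma jspeed_ge0 E x : 0 <= jspeed E x.
Proof. exact: sqrtr_ge0. Qed.

Lemma sqr_jspeed E x : U x <= E -> jspeed E x ^+ 2 = gap E x.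
Proof. by move=> UE; rewrite sqr_sqrtr// mulr_ge0// subr_ge0. Qed.

Lemma jspeed_gt0 E x : U x < E -> 0 < jspeed E x.
Proof. by move=> UE; rewrite sqrtr_gt0 mulr_gt0// subr_gt0. Qed.

Lemma paths_velocity a q : 0 < a -> paths qa qb a q ->
  velocity a q (weak_deriv 0 a q).
Proof. by move=> a0 [Hq _]; exact: H1_velocity. Qed.

Lemma paths_time_change a b h sigma q : 0 < a -> time_change a b h sigma ->
  paths qa qb a q -> paths qa qb b (q \o sigma).
Proof.
move=> a0 tc pq; have vel := paths_velocity a0 pq; have [_ [q0 qa']] := pq.
split; last by rewrite /= (time_change0 a0 tc) (time_change_end a0 tc).
exact: (velocity_H1 (ltW (time_change_gt0 a0 tc)) (velocity_time_change a0 tc vel)).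
Qed.

Lemma action_time_change a b h sigma q : 0 < a -> time_change a b h sigma ->
  paths qa qb a q ->
  action V eps b (q \o sigma) = \int[mu]_(s in `[0, a])
    (2^-1 * (eucl_norm (weak_deriv 0 a q s) ^+ 2 / h s) + - U (q s) * h s).
Proof.
move=> a0 tc pq; have vel := paths_velocity a0 pq.
rewrite -(@functional_time_change _ _ _ _ _ _ _ _ (fun=> 2^-1)
  (fun x => - U x) a0 tc vel)//.
exact: cst_continuous.
Qed.

Lemma jacobi_time_change a h sigma q E : 0 < a -> time_change a 1 h sigma ->
  paths qa qb a q ->
  jacobi V eps E (q \o sigma) = \int[mu]_(s in `[0, a])
    (gap E (q s) * (eucl_norm (weak_deriv 0 a q s) ^+ 2 / h s)).
Proof.
move=> a0 tc pq; have vel := paths_velocity a0 pq.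
transitivity (\int[mu]_(s in `[0, a])
    (gap E (q s) * (eucl_norm (weak_deriv 0 a q s) ^+ 2 / h s) + 0 * h s)).
  rewrite -(@functional_time_change _ _ _ _ _ _ _ _ (gap E) (fun=> 0) a0 tc vel).
  - by apply: eq_Rintegral => t _; rewrite addr0.
  - exact: continuous_gap.
  - exact: cst_continuous.
by apply: eq_Rintegral => t _; rewrite mul0r addr0.
Qed.

Lemma integrable_jlength E a q : 0 < a -> paths qa qb a q ->
  mu.-integrable `[0, a]
    (EFin \o (fun t => jspeed E (q t) * eucl_norm (weak_deriv 0 a q t))).
Proof.
move=> a0 pq; have vel := paths_velocity a0 pq.
by apply: (integrable_along_mul vel (@continuous_jspeed E)); exact: integrable_speed vel.
Qed.

Lemma jlength_ge0 E a q : 0 <= jlength E a q.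
Proof.
by apply: Rintegral_ge0 => t _; rewrite mulr_ge0 ?jspeed_ge0 ?eucl_norm_ge0.
Qed.

(** On a curve of energy [E] the action is the Jacobi length minus [E T]. *)
Lemma action_energy E T q : 0 < T -> paths qa qb T q ->
  has_energy V eps T E q ->
  action V eps T q = jlength E T q - E * T /\
  {ae mu, forall t, t \in `[0, T] -> eucl_norm (weak_deriv 0 T q t) = jspeed E (q t)}.
Proof.
move=> T0 pq en; have vel := paths_velocity T0 pq.
have speedE : {ae mu, forall t, t \in `[0, T] ->
    eucl_norm (weak_deriv 0 T q t) = jspeed E (q t)}.
  apply: ae_imply en => t + ta => /(_ ta) <-.
  rewrite /jspeed /gap -/(U (q t)) addrK mulrA divff// mul1r.
  by rewrite sqrtr_sqr ger0_norm// eucl_norm_ge0.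
split=> //.
transitivity (\int[mu]_(t in `[0, T])
    (jspeed E (q t) * eucl_norm (weak_deriv 0 T q t) - E)); last first.
  rewrite RintegralB//; [|exact: integrable_jlength|exact: cst_itv_integrable].
  by rewrite Rintegral_itv_cst ?subr0// ltW.
apply: ae_eq_Rintegral.
- apply: measurable_funB; last exact: (measurable_along vel cU).
  apply: measurable_funM => //; apply: measurable_funX.
  exact: measurable_speed vel.
- apply: measurable_funB => //; apply: measurable_funM.
    exact: (measurable_along vel (@continuous_jspeed E)).
  exact: measurable_speed vel.
- apply: ae_imply (ae_and en speedE) => t [+ +] ta => /(_ ta) e /(_ ta) <-.
  move: e; rewrite -expr2; set n := _ ^+ 2 => <-.
  by field.
Qed.

(** Used to let the parameter of a family of competitors tend to zero. *)
Lemma le_of_le_add_small (x y c : R) :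
  (forall th, 0 < th -> th <= 2^-1 -> x <= y + th * c) -> x <= y.
Proof.
move=> H; rewrite leNgt; apply/negP => yx.
pose D := x - y; have D0 : 0 < D by rewrite subr_gt0.
pose th := Num.min 2^-1 (D / (2 * (`|c| + 1))).
have c1 : 0 < 2 * (`|c| + 1) by rewrite mulr_gt0// ltr_wpDl.
have th0 : 0 < th by rewrite lt_min invr_gt0 ltr0n/= divr_gt0.
have th1 : th <= D / (2 * (`|c| + 1)) by rewrite ge_min lexx orbT.
have := H th th0; rewrite ge_min lexx => /(_ isT).
have : th * c <= D / 2.
  apply: (@le_trans _ _ (th * (`|c| + 1))).
    by rewrite ler_wpM2l// ?ltW// (le_lt_trans (ler_norm c))// ltrDl.
  apply: le_trans (ler_wpM2r _ th1) _; first by rewrite addr_ge0.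
  by rewrite le_eqVlt; apply/orP; left; apply/eqP; field; rewrite gt_eqF// ltr_wpDl.
rewrite /D; lra.
Qed.

(** A lower bound for the action in time [T] bounds from below the Jacobi
    length of the curves of transit time [T]. Parametrised so as to have
    energy [E], such a curve would have action at most J - E T; as its speed
    may vanish, that parametrisation is only approached. *)
Lemma action_le_jlength E T A gamma : 0 < T ->
  (forall q, paths qa qb T q -> A <= action V eps T q) ->
  paths qa qb 1 gamma -> transit_defined V eps E gamma ->
  transit_time V eps E gamma = T%:E -> A <= jlength E 1 gamma - E * T.
Proof.
move=> T0 minA pg td tt; have vel := paths_velocity ltr01 pg.
set u := weak_deriv 0 1 gamma in vel.
pose n s := eucl_norm (u s).
pose g s := jspeed E (gamma s).
pose r s := n s / g s.
have n0 s : 0 <= n s by exact: eucl_norm_ge0.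
have g0 s : 0 <= g s by exact: jspeed_ge0.
have r0 s : 0 <= r s by rewrite divr_ge0.
have mn : measurable_fun `[0 : R, 1] n by exact: measurable_speed vel.
have mg : measurable_fun `[0 : R, 1] g.
  exact: (measurable_along vel (@continuous_jspeed E)).
have mr : measurable_fun `[0 : R, 1] r.
  by apply: measurable_funM => //; exact: measurable_invr.
have rE : (\int[mu]_(s in `[0%R, 1%R]) (r s)%:E)%E = T%:E by exact: tt.
have ir : mu.-integrable `[0, 1] (EFin \o r).
  apply/integrableP; split; first exact/measurable_EFinP.
  rewrite (_ : (\int[mu]_(s in _) _)%E = T%:E) ?ltry// -rE.
  by apply: eq_integral => s _; rewrite /= ger0_norm.
have rT : \int[mu]_(s in `[0, 1]) r s = T by rewrite /Rintegral rE.
have iU : mu.-integrable `[0, 1] (EFin \o (fun s => - U (gamma s))).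
  have : mu.-integrable `[0, 1] (EFin \o (fun s => - U (gamma s) * 1)).
    by apply: (integrable_along_mul vel cNU); exact: cst_itv_integrable.
  by apply: eq_integrable => // s _; rewrite /= mulr1.
set B := \int[mu]_(s in `[0, 1]) - U (gamma s).
set J := jlength E 1 gamma.
have J0 : 0 <= J by exact: jlength_ge0.
have igu := integrable_jlength E ltr01 pg.
apply: (@le_of_le_add_small _ _ (T * B - 2^-1 * J + E * T + J)) => th th0 th2.
have th1 : 0 < 1 - th by lra.
(* [r] is the rate that gives energy [E]; the term [th * T] keeps the rate
   bounded below without changing the total time [T]. *)
pose h s := (1 - th) * r s + th * T.
have hc s : th * T <= h s by rewrite /h lerDr mulr_ge0// ltW.
have h0 s : 0 < h s by rewrite (lt_le_trans _ (hc s))// mulr_gt0.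
have ih : mu.-integrable `[0, 1] (EFin \o h).
  by apply: integrable_fctD => //; [exact: integrable_fctZ|exact: cst_itv_integrable].
have rh : rate 1 T h.
  split.
  - apply: measurable_funD => //; exact: measurable_funM.
  - by exists (th * T) => [|s _]; [rewrite mulr_gt0|exact: hc].
  - exact: ih.
  - rewrite /clock RintegralD//; [|exact: integrable_fctZ|exact: cst_itv_integrable].
    by rewrite RintegralZl// rT Rintegral_itv_cst//; ring.
have [sigma tc] := rate_time_change ler01 rh.
apply: le_trans (minA _ (paths_time_change ltr01 tc pg)) _.
rewrite (action_time_change ltr01 tc pg) -/u.
pose F s := (2^-1 / (1 - th) + (1 - th) / 2) * (g s * n s) +
  (- ((1 - th) * E) * r s + th * T * - U (gamma s)).
have iF : mu.-integrable `[0, 1] (EFin \o F).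
  apply: integrable_fctD => //; first exact: integrable_fctZ.
  by apply: integrable_fctD => //; exact: integrable_fctZ.
apply: (@le_trans _ _ (\int[mu]_(s in `[0, 1]) F s)).
  apply: ae_le_Rintegral => //.
    apply: integrable_fctD => //.
      by apply: integrable_fctZ => //; exact: integrable_sqr_speed_rate vel rh.
    exact: (integrable_along_mul vel cNU).
  apply: ae_imply td => s + sa => /(_ sa) UE.
  have gs : 0 < g s by exact: jspeed_gt0.
  have nE : n s = r s * g s by rewrite /r divfK// gt_eqF.
  have g2 : g s ^+ 2 = 2 * (E - U (gamma s)) by rewrite sqr_jspeed// ltW.
  have n2h : n s ^+ 2 / h s <= g s * n s / (1 - th).
    rewrite ler_pdivrMr// mulrAC ler_pdivlMr//.
    rewrite (_ : n s ^+ 2 * (1 - th) = g s * n s * ((1 - th) * r s)); last first.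
      by rewrite nE; ring.
    by rewrite ler_wpM2l ?mulr_ge0// /h lerDl mulr_ge0// ltW.
  rewrite -/(n s) /F.
  have -> : - U (gamma s) * h s = (1 - th) / 2 * (g s * n s) +
      (- ((1 - th) * E) * r s + th * T * - U (gamma s)).
    rewrite /h nE (_ : g s * (r s * g s) = r s * g s ^+ 2); last by ring.
    by rewrite g2; field.
  set X := - ((1 - th) * E) * r s + _.
  have -> : (2^-1 / (1 - th) + (1 - th) / 2) * (g s * n s) + X =
      2^-1 * (g s * n s / (1 - th)) + ((1 - th) / 2 * (g s * n s) + X).
    by field; rewrite gt_eqF.
  rewrite lerD2r.
  by rewrite ler_wpM2l// invr_ge0.
have iru : mu.-integrable `[0, 1] (EFin \o (fun s =>
    - ((1 - th) * E) * r s + th * T * - U (gamma s))).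
  by apply: integrable_fctD => //; exact: integrable_fctZ.
rewrite RintegralD//; last exact: integrable_fctZ.
rewrite RintegralZl// RintegralD//; [|exact: integrable_fctZ..].
rewrite !RintegralZl// rT -/B.
have -> : \int[mu]_(s in `[0, 1]) (g s * n s) = J by [].
have : 2^-1 / (1 - th) <= 2^-1 * (1 + 2 * th).
  rewrite ler_wpM2l ?invr_ge0// -[leLHS]mul1r ler_pdivrMr//; nra.
move=> /(ler_wpM2r J0); rewrite !mulrDl; set z := 2^-1 / (1 - th) * J; lra.
Qed.

Lemma jacobi_sqr E gamma : paths qa qb 1 gamma ->
  {ae mu, forall s, s \in `[0, 1] -> U (gamma s) <= E} ->
  jacobi V eps E gamma = \int[mu]_(s in `[0, 1])
    (jspeed E (gamma s) * eucl_norm (weak_deriv 0 1 gamma s)) ^+ 2.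
Proof.
move=> pg UE; have vel := paths_velocity ltr01 pg.
have mn := measurable_speed vel.
apply: ae_eq_Rintegral.
- apply: measurable_funM; last exact: measurable_funX.
  exact: (measurable_along vel (@continuous_gap E)).
- apply: measurable_funX; apply: measurable_funM => //.
  exact: (measurable_along vel (@continuous_jspeed E)).
- by apply: ae_imply UE => s + sa => /(_ sa) e; rewrite exprMn sqr_jspeed.
Qed.

Lemma integrable_sqr_jlength E gamma : paths qa qb 1 gamma ->
  mu.-integrable `[0, 1] (EFin \o (fun s =>
    (jspeed E (gamma s) * eucl_norm (weak_deriv 0 1 gamma s)) ^+ 2)).
Proof.
move=> pg; have vel := paths_velocity ltr01 pg.
have cj2 : continuous (fun x => jspeed E x * jspeed E x).
  by move=> x; apply: (@continuousM _ _ (jspeed E) (jspeed E)); exact: continuous_jspeed.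
have := integrable_along_mul vel cj2 (integrable_sqr_speed vel).
by apply: eq_integrable => // s _; rewrite /= exprMn -expr2.
Qed.

Lemma sqr_jlength_le_jacobi E gamma : paths qa qb 1 gamma ->
  {ae mu, forall s, s \in `[0, 1] -> U (gamma s) <= E} ->
  jlength E 1 gamma ^+ 2 <= jacobi V eps E gamma.
Proof.
move=> pg UE; rewrite jacobi_sqr//; apply: Rintegral01_sqr_le.
  exact: integrable_jlength.
exact: integrable_sqr_jlength.
Qed.

(** A lower bound for the Jacobi functional bounds from below the squared
    Jacobi length of every curve: reparametrise it so that its Jacobi speed
    hardly exceeds its Jacobi length. *)
Lemma jacobi_le_sqr_jlength E T A q : 0 < T ->
  (forall gamma, paths qa qb 1 gamma -> A <= jacobi V eps E gamma) ->
  paths qa qb T q -> (forall t, t \in `[0, T] -> U (q t) <= E) ->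
  A <= jlength E T q ^+ 2.
Proof.
move=> T0 minA pq UE; have vel := paths_velocity T0 pq.
set w := weak_deriv 0 T q in vel; set J := jlength E T q.
have J0 : 0 <= J by exact: jlength_ge0.
apply: (@le_of_le_add_small _ _ (T * J)) => d d0 _.
pose k t := jspeed E (q t) * eucl_norm (w t).
have k0 t : 0 <= k t by rewrite mulr_ge0 ?jspeed_ge0 ?eucl_norm_ge0.
have ik : mu.-integrable `[0, T] (EFin \o k) by exact: integrable_jlength.
pose c := J + d * T.
have c0 : 0 < c by rewrite ltr_wpDl// mulr_gt0.
(* The Jacobi speed with respect to the new parameter is [k / h], at most
   [c]; dividing by [c] makes the total time 1. *)
pose h t := c^-1 * (k t + d).
have ikd : mu.-integrable `[0, T] (EFin \o (fun t => k t + d)).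
  by apply: integrable_fctD => //; exact: cst_itv_integrable.
have ih : mu.-integrable `[0, T] (EFin \o h) by exact: integrable_fctZ.
have hd t : c^-1 * d <= h t.
  by rewrite /h ler_pM2l ?invr_gt0// lerDr.
have h0 t : 0 < h t by rewrite (lt_le_trans _ (hd t))// mulr_gt0 ?invr_gt0.
have rh : rate T 1 h.
  split=> //.
  - by apply/measurable_EFinP; exact: (measurable_int mu ih).
  - by exists (c^-1 * d) => [|t _]; [rewrite mulr_gt0 ?invr_gt0|exact: hd].
  - rewrite /clock RintegralZl// RintegralD//; last exact: cst_itv_integrable.
    by rewrite Rintegral_itv_cst ?ltW// subr0 mulVf// gt_eqF.
have [sigma tc] := rate_time_change (ltW T0) rh.
apply: le_trans (minA _ (paths_time_change T0 tc pq)) _.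
rewrite (jacobi_time_change E T0 tc pq) -/w.
apply: (@le_trans _ _ (\int[mu]_(t in `[0, T]) (c * k t))).
  apply: le_Rintegral => //; last 1 first.
  - move=> t ta; rewrite -(sqr_jspeed (UE t ta)) mulrA -exprMn -/(k t).
    rewrite ler_pdivrMr// /h.
    rewrite (_ : c * k t * (c^-1 * (k t + d)) = k t * (k t + d)); last first.
      by field; rewrite gt_eqF.
    by rewrite expr2 ler_wpM2l// lerDl ltW.
  - apply: (integrable_along_mul vel (@continuous_gap E)).
    exact: integrable_sqr_speed_rate vel rh.
  - exact: integrable_fctZ.
rewrite RintegralZl// -/(jlength E T q) -/J /c.
by rewrite le_eqVlt; apply/orP; left; apply/eqP; ring.
Qed.

(** A minimiser of the action of energy [E], given the parameter for which its
    Jacobi speed is constant, minimises the Jacobi functional at fixed transit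
    time. *)
Lemma minimal_action_minimal_jacobi T E q : 0 < T ->
  minimises (action V eps T) (paths qa qb T) q -> has_energy V eps T E q ->
  (forall t, t \in `[0, T] -> U (q t) < E) ->
  exists psi phi : R -> R, diffeo 0 1 0 T psi phi /\
    minimises (jacobi V eps E)
      [set gamma | [/\ paths qa qb 1 gamma, transit_defined V eps E gamma &
                       transit_time V eps E gamma = T%:E]]
      (q \o psi).
Proof.
move=> T0 [pq minq] en UE; have vel := paths_velocity T0 pq.
have [actionE speedE] := action_energy T0 pq en.
set w := weak_deriv 0 T q in vel speedE.
have [cq _ _ _] := vel.
have cg : {within `[0, T], continuous (fun t => gap E (q t))}.
  exact: (within_continuous_compr cq (@continuous_gap E)).
have mg := measurable_along vel (@continuous_gap E).
have ig := continuous_itv_integrable cg.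
have g0 t : t \in `[0, T] -> 0 < gap E (q t).
  by move=> ta; rewrite mulr_gt0// subr_gt0 UE.
have [t0 t0T gmin] := EVT_min (ltW T0) cg.
pose C := \int[mu]_(t in `[0, T]) gap E (q t).
have C0 : 0 < C.
  apply: (@lt_le_trans _ _ (gap E (q t0) * T)); first by rewrite mulr_gt0// g0.
  rewrite /C -[X in _ * X]subr0 -(Rintegral_itv_cst _ (ltW T0)).
  by apply: le_Rintegral => //; exact: cst_itv_integrable.
(* On [q] the Jacobi speed is [gap E]; dividing by [h] makes it constant. *)
pose h t := C^-1 * gap E (q t).
have ch : {within `[0, T], continuous h}.
  apply: (within_continuous_compr cq (K := fun x => C^-1 * gap E x)) => x.
  apply: (@continuousM _ _ (fun=> C^-1) (gap E)); first exact: cst_continuous.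
  exact: continuous_gap.
have rh : rate T 1 h.
  split.
  - exact: subspace_continuous_measurable_fun.
  - exists (C^-1 * gap E (q t0)); first by rewrite mulr_gt0 ?invr_gt0// g0.
    by move=> t ta; rewrite /h ler_pM2l ?invr_gt0// gmin.
  - exact: continuous_itv_integrable.
  - by rewrite /clock RintegralZl// mulVf// gt_eqF.
have [sigma tc] := rate_time_change (ltW T0) rh.
have [_ [_ sT _ _]] := tc.
exists sigma, (clock h); split.
  exact: diffeo_sym (time_change_diffeo T0 tc ch).
have ps := paths_time_change T0 tc pq.
have vels := paths_velocity ltr01 ps.
have mV : measurable_fun `[0, T] (fun t => (h t)^-1).
  apply: measurable_invr => [t ta|]; last exact: subspace_continuous_measurable_fun.
  by rewrite ltW// mulr_gt0 ?invr_gt0// g0.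
have lengthC : jlength E T q = C.
  apply: ae_eq_Rintegral => //.
  - apply: measurable_funM; last exact: measurable_speed vel.
    exact: (measurable_along vel (@continuous_jspeed E)).
  - apply: ae_imply speedE => t + ta => /(_ ta) ->.
    by rewrite -expr2 sqr_jspeed// ltW// UE.
split.
  split => //=.
  - by apply: aeW => s _; exact: UE.
  - transitivity (\int[mu]_(s in `[0%R, 1%R]) ((h (sigma s))^-1)%:E)%E.
      apply: ae_eq_integral => //.
      + apply/measurable_EFinP; apply: measurable_funM.
          exact: measurable_speed vels.
        apply: measurable_invr => [s _|]; first exact: jspeed_ge0.
        exact: (measurable_along vels (@continuous_jspeed E)).
      + by apply/measurable_EFinP; exact: (measurable_time_change tc mV).
      + apply: ae_imply (ae_and (weak_deriv_time_change T0 tc vel)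
          (ae_time_change T0 tc speedE)) => s [+ +] sa => /(_ sa) + /(_ sa).
        move=> -> e; congr EFin; rewrite eucl_normZ e ger0_norm; last first.
          by rewrite invr_ge0 ltW// (rate_gt0 tc).
        by rewrite mulfK// gt_eqF// jspeed_gt0// UE.
    rewrite (integral_substitution T0 tc mV).
    rewrite (_ : (\int[mu]_(s in _) _)%E = (\int[mu]_(s in `[0%R, T]) (1 : R)%:E)%E).
      rewrite -[LHS]fineK; last first.
        by apply: integrable_fin_num => //; exact: cst_itv_integrable.
      congr EFin; rewrite -[LHS]/(\int[mu]_(s in `[0, T]) 1).
      by rewrite Rintegral_itv_cst ?ltW// subr0 mul1r.
    apply: eq_integral => s; rewrite mem_setE => sa.
    by rewrite mulVf// gt_eqF// (rate_gt0 tc sa).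
move=> gamma [pg td tt].
have -> : jacobi V eps E (q \o sigma) = C ^+ 2.
  rewrite (jacobi_time_change E T0 tc pq) -/w.
  rewrite (@ae_eq_Rintegral _ T _ (fun t => C * gap E (q t))).
  - by rewrite RintegralZl.
  - apply: measurable_funM => //; apply: measurable_funM => //.
    by apply: measurable_funX; exact: measurable_speed vel.
  - exact: measurable_funM.
  - apply: ae_imply speedE => t + ta => /(_ ta) ->.
    rewrite sqr_jspeed ?ltW ?UE// /h; field.
    by rewrite !gt_eqF// g0.
have CJ : C <= jlength E 1 gamma.
  have := action_le_jlength T0 minq pg td tt.
  by rewrite actionE lengthC lerD2r.
apply: (@le_trans _ _ (jlength E 1 gamma ^+ 2)).
  by rewrite ler_pXn2r// nnegrE ltW// (lt_le_trans C0).
apply: sqr_jlength_le_jacobi => //.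
by apply: ae_imply td => s + sa => /(_ sa) /ltW.
Qed.

(** A minimiser of the Jacobi functional, given the parameter for which its
    energy is [E], minimises the action at fixed energy. *)
Lemma minimal_jacobi_minimal_action E T gamma : 0 < E ->
  (forall x, V x <= 0) ->
  minimises (jacobi V eps E) (paths qa qb 1) gamma -> 0 < T ->
  transit_time V eps E gamma = T%:E ->
  exists psi phi : R -> R, diffeo 0 1 0 T psi phi /\
    minimises (action V eps T)
      [set q | paths qa qb T q /\ has_energy V eps T E q] (gamma \o phi).
Proof.
move=> E0 V0 [pg ming] T0 tt; have vel := paths_velocity ltr01 pg.
set u := weak_deriv 0 1 gamma in vel.
have [cgam _ _ _] := vel.
have UE x : U x < E by rewrite (le_lt_trans (V0 _)).
have g0 x : 0 < gap E x by rewrite mulr_gt0// subr_gt0.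
have j0 x : 0 < jspeed E x by exact: jspeed_gt0.
have j2 x : jspeed E x ^+ 2 = gap E x by rewrite sqr_jspeed// ltW.
set J := jlength E 1 gamma.
have J_ge0 : 0 <= J by exact: jlength_ge0.
have aeUE : {ae mu, forall s, s \in `[0, 1] -> U (gamma s) <= E}.
  by apply: aeW => s _; exact: ltW.
have J2le : J ^+ 2 <= jacobi V eps E gamma by exact: sqr_jlength_le_jacobi.
have le_len a q : 0 < a -> paths qa qb a q -> jacobi V eps E gamma <= jlength E a q ^+ 2.
  by move=> a0 pq; apply: (jacobi_le_sqr_jlength a0 ming pq) => t _; exact: ltW.
(* The minimiser realises equality in the Cauchy-Schwarz inequality. *)
have speedE : {ae mu, forall s, s \in `[0, 1] ->
    jspeed E (gamma s) * eucl_norm (u s) = J}.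
  apply: Rintegral01_sqr_eq.
  - exact: integrable_jlength.
  - exact: integrable_sqr_jlength.
  - by rewrite -jacobi_sqr//; exact: le_len.
have cgapV : continuous (fun x => (gap E x)^-1).
  by move=> x; exact: (cvgV (lt0r_neq0 (g0 x)) (@continuous_gap E x)).
have cgV : {within `[0, 1], continuous (fun s => (gap E (gamma s))^-1)}.
  exact: (within_continuous_compr cgam cgapV).
have igV := continuous_itv_integrable cgV.
have mgV := measurable_along vel cgapV.
(* The speed of [gamma] is [J / jspeed], so this rate brings it to [jspeed]. *)
pose h s := J * (gap E (gamma s))^-1.
have hT : \int[mu]_(s in `[0, 1]) h s = T.
  rewrite -[RHS]/(fine T%:E) -tt; apply: ae_eq_Rintegral.
  - exact: measurable_funM.
  - apply: measurable_funM; first exact: measurable_speed vel.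
    apply: measurable_invr => [s _|]; first exact: jspeed_ge0.
    exact: (measurable_along vel (@continuous_jspeed E)).
  - apply: ae_imply speedE => s + sa => /(_ sa) e.
    rewrite /h -e -j2 -/u -/(jspeed E (gamma s)); field.
    by rewrite gt_eqF.
have J0 : 0 < J.
  rewrite lt_neqAle J_ge0 andbT; apply/eqP => J0.
  move: T0; rewrite -hT /h -J0 RintegralZl// mul0r ltxx//.
have ch : {within `[0, 1], continuous h}.
  apply: (within_continuous_compr cgam (K := fun x => J * (gap E x)^-1)) => x.
  apply: (@continuousM _ _ (fun=> J) (fun x => (gap E x)^-1)); first exact: cst_continuous.
  exact: cgapV.
have [s0 s01 hmin] := EVT_min ler01 ch.
have h0 s : 0 < h s by rewrite mulr_gt0// invr_gt0.
have rh : rate 1 T h.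
  split.
  - exact: subspace_continuous_measurable_fun.
  - by exists (h s0).
  - exact: continuous_itv_integrable.
  - exact: hT.
have [sigma tc] := rate_time_change ler01 rh.
exists (clock h), sigma; split; first exact: (time_change_diffeo ltr01 tc ch).
have ps := paths_time_change ltr01 tc pg.
have vels := paths_velocity T0 ps.
have ens : has_energy V eps T E (gamma \o sigma).
  apply: ae_imply (ae_and (weak_deriv_time_change ltr01 tc vel)
    (ae_time_change ltr01 tc speedE)) => t [+ +] ta => /(_ ta) + /(_ ta).
  move=> -> e; rewrite eucl_normZ ger0_norm; last by rewrite invr_ge0 ltW.
  have nE : eucl_norm (u (sigma t)) = J / jspeed E (gamma (sigma t)).
    by rewrite -e mulrAC divff ?mul1r// gt_eqF.
  have -> : (h (sigma t))^-1 * eucl_norm (u (sigma t)) = jspeed E (gamma (sigma t)).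
    by rewrite nE /h -j2; field; rewrite !gt_eqF.
  by rewrite j2 /gap /= /U; field.
split=> [//|q [pq enq]].
have [-> speeds] := action_energy T0 ps ens.
have [-> _] := action_energy T0 pq enq.
rewrite lerD2r.
have -> : jlength E T (gamma \o sigma) = J.
  have mgap := measurable_along vel (@continuous_gap E).
  transitivity (\int[mu]_(t in `[0, T]) gap E (gamma (sigma t))).
    apply: ae_eq_Rintegral.
    - apply: measurable_funM; last exact: measurable_speed vels.
      exact: (measurable_along vels (@continuous_jspeed E)).
    - exact: (measurable_along vels (@continuous_gap E)).
    - by apply: ae_imply speeds => t + ta => /(_ ta) ->; rewrite -expr2 j2.
  rewrite (Rintegral_substitution ltr01 tc mgap).
  transitivity (\int[mu]_(s in `[0, 1]) J).
    by apply: eq_Rintegral => s _; rewrite /h; field; rewrite gt_eqF.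
  by rewrite Rintegral_itv_cst// subr0 mulr1.
have J2len := le_trans J2le (le_len _ _ T0 pq).
have Jn : J \is Num.nneg by rewrite nnegrE.
have qn : jlength E T q \is Num.nneg by rewrite nnegrE jlength_ge0.
by rewrite -(ler_sqr Jn qn).
Qed.

End maupertuis.

Unset Implicit Arguments.

Theorem theorem4p3 (R : realType) (m : nat) (V : 'rV[R]_m -> R)
  (V_C2 : Ck 2 V) (V_bounded : bounded_fun V) (V_max : has_max V 0)
  (qa qb : 'rV[R]_m) :
  (forall (T eps : R), 0 < T -> 0 < eps ->
   forall qbar : R -> 'rV[R]_m,
     minimises (action V eps T) (paths qa qb T) qbar ->
   forall ET : R, has_energy V eps T ET qbar ->
     (forall t, t \in `[0, T] -> V (eps^-1 *: qbar t) < ET) ->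
   exists psi phi : R -> R, diffeo 0 1 0 T psi phi /\
     minimises (jacobi V eps ET)
       [set gamma | [/\ paths qa qb 1 gamma, transit_defined V eps ET gamma &
                        transit_time V eps ET gamma = T%:E]]
       (qbar \o psi)) /\
  (forall (E eps : R), 0 < E -> 0 < eps ->
   forall gammabar : R -> 'rV[R]_m,
     minimises (jacobi V eps E) (paths qa qb 1) gammabar ->
   forall TE : R, 0 < TE -> transit_time V eps E gammabar = TE%:E ->
   exists psi phi : R -> R, diffeo 0 1 0 TE psi phi /\
     minimises (action V eps TE)
       [set q | paths qa qb TE q /\ has_energy V eps TE E q]
       (gammabar \o phi)).
Proof.
have cV : continuous V := V_C2.1.
split=> [T eps T0 eps0 qbar minq ET en VE|E eps E0 eps0 gammabar ming TE TE0 tt].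
  exact: (minimal_action_minimal_jacobi cV T0 minq en VE).
exact: (minimal_jacobi_minimal_action cV E0 V_max.2 ming TE0 tt).
Qed.
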